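(* Let Assumptions A and B hold and run the algorithm with restriction $r=\sigma^{\mathrm{ASY}}\mathbf 1$, i.e. with $\sum_{i=1}^N y_i^0=b-\sigma^{\mathrm{ASY}}\mathbf 1$ (and $M$ sufficiently large so that the allocation sequence converges). Let $(y_1^t,\dots,y_N^t)\to(y_1^\infty,\dots,y_N^\infty)$, and for each $i$ let $(\rho_i^\infty,\xi_i^\infty,x_i^\infty)$ be a lex-optimal solution of (P3) with $y_i^t$ replaced by $y_i^\infty$. Then $(x_1^\infty,\dots,x_N^\infty)$ is feasible for the MILP: $x_i^\infty\in X_i$ for all $i$ and $\sum_{i=1}^N A_i x_i^\infty\preceq b$.
   Context: Data: for each $i\in\{1,\dots,N\}$, $c_i\in\mathbb{R}^{n_i}$, $A_i\in\mathbb{R}^{S\times n_i}$ (rows $A_i^s$), nonempty compact $X_i=\{x_i\in\mathbb{Z}^{Z_i}\times\mathbb{R}^{R_i}:D_ix_i\preceq d_i\}$; $b\in\mathbb{R}^S$. $\preceq$ is componentwise, $\mathbf 1$ the all-ones vector. MILP: minimize $\sum_i c_i^\top x_i$ s.t. $\sum_i A_ix_i\preceq b$, $x_i\in X_i$ (assumed feasible). Restricted LP (LP$_r$) for $r\succeq 0$: minimize $\sum_i c_i^\top z_i$ s.t. $\sum_iA_iz_i\preceq b-r$, $z_i\in\mathrm{conv}(X_i)$. Assumption A: (LP$_r$) (with the restriction $r$ used) is feasible with unique optimal solution. Assumption B: step-sizes $\alpha^t\ge0$ with $\sum_t\alpha^t=\infty$, $\sum_t(\alpha^t)^2<\infty$.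 Restriction: $L_i^s=\min_{x_i\in X_i}A_i^sx_i$, $L_i=(L_i^1,\dots,L_i^S)$; $(x_i^L,\tilde\ell_i)$ an optimal solution of minimize $\ell_i$ over $x_i\in X_i,\ell_i\in\mathbb{R}$ s.t. $A_ix_i-L_i\preceq\ell_i\mathbf 1$; $\sigma^{\mathrm{ASY}}=(S+1)\max_{i}\max_{s}(A_i^sx_i^L-L_i^s)$. Algorithm over a connected undirected graph with neighbor sets $\mathcal N_i$, parameter $M>0$, initialization $\sum_iy_i^0=b-r$. At each $t$, agent $i$: (P1) computes a primal-dual optimal pair $((z_i^t,v_i^t),\mu_i^t)$ of: minimize $c_i^\top z_i+Mv_i$ over $z_i\in\mathrm{conv}(X_i)$, $v_i\ge0$, s.t. $A_iz_i\preceq y_i^t+v_i\mathbf 1$ ($\mu_i^t$ the multiplier of this constraint); (P2) $y_i^{t+1}=y_i^t+\alpha^t\sum_{j\in\mathcal N_i}(\mu_i^t-\mu_j^t)$; (P3) computes $x_i^t$ via the lexicographic problem: minimize lexicographically $(\rho_i,\xi_i)$ over $x_i\in X_i$, $\rho_i\ge0$, $\xi_i$, s.t. $c_i^\top x_i\le\xi_i$, $A_ix_i\preceq y_i^t+\rho_i\mathbf 1$. Equivalently: first $\rho_i^t$ is the minimal $\rho_i\ge0$ such that some $x_i\in X_i$ has $A_ix_i\preceq y_i^t+\rho_i\mathbf 1$; then $x_i^t$ minimizes $c_i^\top x_i$ over $x_i\in X_i$ with $A_ix_i\preceq y_i^t+\rho_i^t\mathbf 1$. *)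

(* Defs.v *)
(* Stdlib (classical reals R). Vectors are functions nat -> R;
   only the first coordinates (below the relevant dimension) matter. *)
From Stdlib Require Import Reals ZArith.
Open Scope R_scope.

Fixpoint rsum (n : nat) (f : nat -> R) : R :=
  match n with O => 0 | S k => rsum k f + f k end.

(* Problem data. Agents i < nag, coupling constraints s < ncon. *)
Record milp_data := MkData {
  nag   : nat;
  ncon  : nat;
  nZ    : nat -> nat;                (* Z_i : number of integer coordinates *)
  nRc   : nat -> nat;                (* R_i : number of real coordinates *)
  cost  : nat -> nat -> R;
  Acoup : nat -> nat -> nat -> R;
  nloc  : nat -> nat;                (* number of rows of D_i *)
  Dloc  : nat -> nat -> nat -> R;
  dloc  : nat -> nat -> R;
  bcoup : nat -> R
}.

Section Defs.
Variable P : milp_data.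

Definition dim (i : nat) : nat := (nZ P i + nRc P i)%nat.

Definition Ax (i s : nat) (x : nat -> R) : R :=
  rsum (dim i) (fun k => Acoup P i s k * x k).
Definition cx (i : nat) (x : nat -> R) : R :=
  rsum (dim i) (fun k => cost P i k * x k).

(* x in X_i  (x in Z^{Z_i} x R^{R_i}, padded by zeros, with D_i x <= d_i) *)
Definition inX (i : nat) (x : nat -> R) : Prop :=
  (forall k, (dim i <= k)%nat -> x k = 0) /\
  (forall k, (k < nZ P i)%nat -> exists z : Z, x k = IZR z) /\
  (forall j, (j < nloc P i)%nat ->
     rsum (dim i) (fun k => Dloc P i j k * x k) <= dloc P i j).

Definition inconv (i : nat) (z : nat -> R) : Prop :=
  exists (p : nat) (w : nat -> R) (xs : nat -> nat -> R),
    (forall j, (j < p)%nat -> 0 <= w j /\ inX i (xs j)) /\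
    rsum p w = 1 /\
    (forall k, z k = rsum p (fun j => w j * xs j k)).

(* each X_i nonempty and compact (X_i is closed, so compact = bounded) *)
Definition local_sets_ok : Prop :=
  forall i, (i < nag P)%nat ->
    (exists x, inX i x) /\
    (exists B, forall x, inX i x -> forall k, Rabs (x k) <= B).

Definition milp_feasible (x : nat -> nat -> R) : Prop :=
  (forall i, (i < nag P)%nat -> inX i (x i)) /\
  (forall s, (s < ncon P)%nat ->
     rsum (nag P) (fun i => Ax i s (x i)) <= bcoup P s).

Definition lpr_feasible (r : nat -> R) (z : nat -> nat -> R) : Prop :=
  (forall i, (i < nag P)%nat -> inconv i (z i)) /\
  (forall s, (s < ncon P)%nat ->
     rsum (nag P) (fun i => Ax i s (z i)) <= bcoup P s - r s).

Definition lpr_obj (z : nat -> nat -> R) : R :=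
  rsum (nag P) (fun i => cx i (z i)).

Definition lpr_optimal (r : nat -> R) (z : nat -> nat -> R) : Prop :=
  lpr_feasible r z /\
  (forall z', lpr_feasible r z' -> lpr_obj z <= lpr_obj z').

Definition assumptionA (r : nat -> R) : Prop :=
  exists z, lpr_optimal r z /\
    (forall z', lpr_optimal r z' ->
       forall i k, (i < nag P)%nat -> z' i k = z i k).

Definition is_L (L : nat -> nat -> R) : Prop :=
  forall i s, (i < nag P)%nat -> (s < ncon P)%nat ->
    (exists x, inX i x /\ Ax i s x = L i s) /\
    (forall x, inX i x -> L i s <= Ax i s x).

Definition is_xL (L : nat -> nat -> R) (xL : nat -> nat -> R) (lt : nat -> R)
  : Prop :=
  forall i, (i < nag P)%nat ->
    inX i (xL i) /\
    (forall s, (s < ncon P)%nat -> Ax i s (xL i) - L i s <= lt i) /\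
    (forall x l, inX i x ->
       (forall s, (s < ncon P)%nat -> Ax i s x - L i s <= l) -> lt i <= l).

Definition is_sigmaASY (L xL : nat -> nat -> R) (sigma : R) : Prop :=
  exists mx,
    sigma = INR (ncon P + 1) * mx /\
    (exists i s, (i < nag P)%nat /\ (s < ncon P)%nat /\
                 mx = Ax i s (xL i) - L i s) /\
    (forall i s, (i < nag P)%nat -> (s < ncon P)%nat ->
                 Ax i s (xL i) - L i s <= mx).

Definition lag1 (M : R) (i : nat) (y : nat -> R) (z : nat -> R) (v : R)
  (mu : nat -> R) : R :=
  cx i z + M * v + rsum (ncon P) (fun s => mu s * (Ax i s z - y s - v)).

Definition p1_feasible (i : nat) (y : nat -> R) (z : nat -> R) (v : R) : Prop :=
  inconv i z /\ 0 <= v /\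
  (forall s, (s < ncon P)%nat -> Ax i s z <= y s + v).

(* ((z,v),mu) is a primal-dual optimal pair of (P1) (Lagrangian duality of the
   constraint A_i z <= y + v 1 only): (z,v) primal optimal, mu >= 0,
   (z,v) minimizes the Lagrangian at mu, complementary slackness. *)
Definition p1_pd_optimal (M : R) (i : nat) (y : nat -> R) (z : nat -> R)
  (v : R) (mu : nat -> R) : Prop :=
  p1_feasible i y z v /\
  (forall z' v', p1_feasible i y z' v' -> cx i z + M * v <= cx i z' + M * v') /\
  (forall s, (s < ncon P)%nat -> 0 <= mu s) /\
  (forall z' v', inconv i z' -> 0 <= v' ->
     lag1 M i y z v mu <= lag1 M i y z' v' mu) /\
  rsum (ncon P) (fun s => mu s * (Ax i s z - y s - v)) = 0.

Definition p3_feasible (i : nat) (y : nat -> R) (rho xi : R) (x : nat -> R)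
  : Prop :=
  inX i x /\ 0 <= rho /\ cx i x <= xi /\
  (forall s, (s < ncon P)%nat -> Ax i s x <= y s + rho).

Definition p3_lexopt (i : nat) (y : nat -> R) (rho xi : R) (x : nat -> R)
  : Prop :=
  p3_feasible i y rho xi x /\
  (forall rho' xi' x', p3_feasible i y rho' xi' x' ->
     rho < rho' \/ (rho = rho' /\ xi <= xi')).

End Defs.

Definition assumptionB (alpha : nat -> R) : Prop :=
  (forall t, 0 <= alpha t) /\
  (forall B, exists T, B < rsum T alpha) /\
  (exists l, Un_cv (fun T => rsum T (fun t => alpha t ^ 2)) l).

Inductive reach (N : nat) (adj : nat -> nat -> bool) (i : nat) : nat -> Prop :=
| reach_refl : reach N adj i i
| reach_step : forall j k, reach N adj i j -> (j < N)%nat -> (k < N)%nat ->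
    adj j k = true -> reach N adj i k.

Definition connected_undirected (N : nat) (adj : nat -> nat -> bool) : Prop :=
  (forall i j, adj i j = adj j i) /\
  (forall i j, (i < N)%nat -> (j < N)%nat -> reach N adj i j).

(* Main.v *)
Require Import Defs.
From Stdlib Require Import Reals ZArith Lra Lia Psatz List.
From Stdlib Require Import Classical ClassicalEpsilon FunctionalExtensionality.
Open Scope R_scope.

(** Each agent's cost-to-go has [- mu_i^t] as a subgradient at [y_i^t], so a
convergent allocation sequence has an optimal limit of the penalized problem.
For large [M] the penalty is exact because conv(X_i) is a polyhedron; since
polyhedra are stable under projection, the set of attainable (resource, cost)
pairs is closed, and the limit allocation carries an optimal solution of (LP_r).
This solution is unique, hence extreme: if more than S of its blocks were
outside X_i, S linear constraints on S + 1 feasible directions would leave a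
nonzero direction to move in. An agent whose block is in X_i has rho_i = 0, any
other has rho_i at most max_s (A_i^s x_i^L - L_i^s), and the restriction pays
for these violations. *)

(** * Finite sums *)

(** The obstacle is that neither [z t] nor [mu t] is known to converge, so no optimality condition
    can be passed to the limit along them. What the iterates do give is near-optimality at
    arbitrarily late times, with violations as small as desired; a closedness argument then replaces
    the extraction of a convergent subsequence. Exactness of the penalty hinges on the slope of the
    optimal value under relaxation of the constraints, which for a general convex set could be
    infinite at b - r. Both arguments ask for conv(X_i) as a finite system of inequalities, whereas
    it is given through convex combinations; producing that system is the purpose of the elimination
    and disjunctive constructions. *)

Lemma rsum_ext n f g : (forall k, (k < n)%nat -> f k = g k) -> rsum n f = rsum n g.
Proof.
  induction n as [|n IH]; intros H; simpl; [reflexivity|].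
  rewrite IH, H; auto.
Qed.

Lemma rsum_zero n f : (forall k, (k < n)%nat -> f k = 0) -> rsum n f = 0.
Proof.
  induction n as [|n IH]; intros H; simpl; [reflexivity|].
  rewrite IH, H; auto; lra.
Qed.

Lemma rsum_plus n f g : rsum n (fun k => f k + g k) = rsum n f + rsum n g.
Proof. induction n as [|n IH]; simpl; [|rewrite IH]; lra. Qed.

Lemma rsum_minus n f g : rsum n (fun k => f k - g k) = rsum n f - rsum n g.
Proof. induction n as [|n IH]; simpl; [|rewrite IH]; lra. Qed.

Lemma rsum_scal n c f : rsum n (fun k => c * f k) = c * rsum n f.
Proof. induction n as [|n IH]; simpl; [|rewrite IH]; lra. Qed.

Lemma rsum_le n f g :
  (forall k, (k < n)%nat -> f k <= g k) -> rsum n f <= rsum n g.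
Proof.
  induction n as [|n IH]; intros H; simpl; [lra|].
  apply Rplus_le_compat; auto.
Qed.

Lemma rsum_nonneg n f : (forall k, (k < n)%nat -> 0 <= f k) -> 0 <= rsum n f.
Proof.
  intros H. rewrite <- (rsum_zero n (fun _ => 0)); auto using rsum_le.
Qed.

Lemma rsum_const n c : rsum n (fun _ => c) = INR n * c.
Proof. induction n as [|n IH]; [simpl; lra|]. rewrite S_INR. simpl. lra. Qed.

Lemma rsum_term_le n f i :
  (forall k, (k < n)%nat -> 0 <= f k) -> (i < n)%nat -> f i <= rsum n f.
Proof.
  induction n as [|n IH]; intros H Hi; simpl; [lia|].
  assert (0 <= rsum n f) by auto using rsum_nonneg.
  assert (0 <= f n) by auto.
  destruct (Nat.eq_dec i n) as [->|]; [lra|].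
  assert (f i <= rsum n f) by (apply IH; [auto|lia]). lra.
Qed.

Lemma rsum_swap n m (f : nat -> nat -> R) :
  rsum n (fun i => rsum m (fun j => f i j)) =
  rsum m (fun j => rsum n (fun i => f i j)).
Proof.
  induction n as [|n IH]; simpl.
  - symmetry; apply rsum_zero; auto.
  - rewrite IH, <- rsum_plus. reflexivity.
Qed.

Lemma rsum_single n p (f : nat -> R) :
  (p < n)%nat -> rsum n (fun k => if (k =? p)%nat then f k else 0) = f p.
Proof.
  induction n as [|n IH]; intros H; simpl; [lia|].
  destruct (Nat.eqb_spec n p) as [->|].
  - rewrite rsum_zero; [lra|].
    intros k Hk. destruct (Nat.eqb_spec k p); [lia|reflexivity].
  - rewrite IH; [lra|lia].
Qed.

Lemma rsum_app p q f :
  rsum (p + q) f = rsum p f + rsum q (fun j => f (p + j)%nat).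
Proof.
  induction q as [|q IH]; simpl.
  - rewrite Nat.add_0_r; lra.
  - rewrite Nat.add_succ_r; simpl. rewrite IH; lra.
Qed.

Lemma rsum_exists_pos n f :
  0 < rsum n f -> exists k, (k < n)%nat /\ 0 < f k.
Proof.
  induction n as [|n IH]; simpl; intros H; [lra|].
  destruct (Rlt_dec 0 (f n)); [exists n; auto|].
  destruct IH as [k [Hk Hf]]; [lra|]. exists k; auto.
Qed.

(** * Polyhedra and Fourier-Motzkin elimination *)

Definition lin (n : nat) (a x : nat -> R) : R := rsum n (fun k => a k * x k).

Definition aff (n : nat) (f : (nat -> R) -> R) : Prop :=
  exists a c, forall x, f x = lin n a x + c.

(** Points are whole sequences of which only the first [n] coordinates can matter. All dimensions
    then share one type, and projections and products need no casts. *)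
Definition polyhedron (n : nat) (Q : (nat -> R) -> Prop) : Prop :=
  exists rows : list ((nat -> R) * R),
    forall x, Q x <-> forall r, In r rows -> lin n (fst r) x <= snd r.

Lemma lin_ext n a x x' :
  (forall k, (k < n)%nat -> x k = x' k) -> lin n a x = lin n a x'.
Proof. intros H. apply rsum_ext; intros k Hk. rewrite H; auto. Qed.

Lemma aff_const n c : aff n (fun _ => c).
Proof.
  exists (fun _ => 0), c. intros x. unfold lin. rewrite rsum_zero; intros; lra.
Qed.

Lemma aff_coord n k : (k < n)%nat -> aff n (fun x => x k).
Proof.
  intros H. exists (fun j => if (j =? k)%nat then 1 else 0), 0. intros x.
  unfold lin.
  rewrite rsum_ext with (g := fun j => if (j =? k)%nat then x j else 0).
  - rewrite rsum_single; auto; lra.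
  - intros j _. destruct (j =? k)%nat; lra.
Qed.

Lemma aff_plus n f g : aff n f -> aff n g -> aff n (fun x => f x + g x).
Proof.
  intros [a [c H]] [a' [c' H']]. exists (fun k => a k + a' k), (c + c').
  intros x. rewrite H, H'. unfold lin.
  rewrite (rsum_ext _ (fun k => (a k + a' k) * x k)
             (fun k => a k * x k + a' k * x k)) by (intros; lra).
  rewrite rsum_plus; lra.
Qed.

Lemma aff_scal n c f : aff n f -> aff n (fun x => c * f x).
Proof.
  intros [a [c' H]]. exists (fun k => c * a k), (c * c').
  intros x. rewrite H. unfold lin.
  rewrite (rsum_ext _ (fun k => c * a k * x k)
             (fun k => c * (a k * x k))) by (intros; lra).
  rewrite rsum_scal; lra.
Qed.

Lemma aff_ext n f g : (forall x, f x = g x) -> aff n f -> aff n g.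
Proof. intros E [a [c H]]. exists a, c. intros x. rewrite <- E; auto. Qed.

Lemma aff_minus n f g : aff n f -> aff n g -> aff n (fun x => f x - g x).
Proof.
  intros Hf Hg. apply aff_ext with (fun x => f x + (-1) * g x).
  - intros; lra.
  - auto using aff_plus, aff_scal.
Qed.

Lemma aff_rsum n p (f : nat -> (nat -> R) -> R) :
  (forall j, (j < p)%nat -> aff n (f j)) ->
  aff n (fun x => rsum p (fun j => f j x)).
Proof.
  induction p as [|p IH]; intros H; simpl; [apply aff_const|].
  apply aff_plus; auto.
Qed.

Lemma polyhedron_ext n Q Q' : (forall x, Q x <-> Q' x) -> polyhedron n Q -> polyhedron n Q'.
Proof. intros E [rows H]. exists rows. intros x. rewrite <- E. apply H. Qed.

Lemma polyhedron_coords n Q x x' :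
  polyhedron n Q -> (forall k, (k < n)%nat -> x k = x' k) -> Q x -> Q x'.
Proof.
  intros [rows H] E. rewrite !H. intros Hx r Hr.
  rewrite <- (lin_ext n _ x x'); auto.
Qed.

Lemma polyhedron_true n : polyhedron n (fun _ => True).
Proof. exists nil. intros x; split; [intros _ r []|auto]. Qed.

Lemma polyhedron_le n f g : aff n f -> aff n g -> polyhedron n (fun x => f x <= g x).
Proof.
  intros Hf Hg. destruct (aff_minus _ _ _ Hf Hg) as [a [c H]].
  exists ((a, - c) :: nil). intros x. specialize (H x). simpl. split.
  - intros Hx r [<-|[]]. simpl. lra.
  - intros Hr. specialize (Hr _ (or_introl eq_refl)). simpl in Hr. lra.
Qed.

Lemma polyhedron_and n Q Q' : polyhedron n Q -> polyhedron n Q' -> polyhedron n (fun x => Q x /\ Q' x).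
Proof.
  intros [l H] [l' H']. exists (l ++ l'). intros x. rewrite H, H'.
  split.
  - intros [Hl Hl'] r Hr. apply in_app_or in Hr. destruct Hr; auto.
  - intros Hr; split; intros r Hin; apply Hr; apply in_or_app; auto.
Qed.

Lemma polyhedron_eq n f g : aff n f -> aff n g -> polyhedron n (fun x => f x = g x).
Proof.
  intros Hf Hg. apply polyhedron_ext with (fun x => f x <= g x /\ g x <= f x).
  - intros x; split; [lra|intros ->; lra].
  - auto using polyhedron_and, polyhedron_le.
Qed.

(** [A] does not mention the point, so it can be decided classically. Sign tests on coefficients may
    thus guard the rows of a system. *)
Lemma polyhedron_imp n (A : Prop) Q : (A -> polyhedron n Q) -> polyhedron n (fun x => A -> Q x).
Proof.
  intros H. destruct (classic A) as [HA|HA].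
  - apply polyhedron_ext with Q; [tauto|auto].
  - apply polyhedron_ext with (fun _ => True); [tauto|apply polyhedron_true].
Qed.

Lemma polyhedron_forall_list {T} n (l : list T) (Q : T -> (nat -> R) -> Prop) :
  (forall r, In r l -> polyhedron n (Q r)) ->
  polyhedron n (fun x => forall r, In r l -> Q r x).
Proof.
  induction l as [|r l IH]; intros H.
  - apply polyhedron_ext with (fun _ => True); [|apply polyhedron_true].
    intros x; split; [intros _ r []|auto].
  - apply polyhedron_ext with (fun x => Q r x /\ forall r', In r' l -> Q r' x).
    + intros x; split.
      * intros [H1 H2] r' [<-|Hr]; auto.
      * intros Hr; split; [|intros]; apply Hr; simpl; auto.
    + apply polyhedron_and; [|apply IH; intros]; apply H; simpl; auto.
Qed.

Lemma polyhedron_forall_lt n p (Q : nat -> (nat -> R) -> Prop) :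
  (forall j, (j < p)%nat -> polyhedron n (Q j)) ->
  polyhedron n (fun x => forall j, (j < p)%nat -> Q j x).
Proof.
  intros H.
  apply polyhedron_ext with (fun x => forall j, In j (seq 0 p) -> Q j x).
  - intros x; split; intros Hx j Hj; apply Hx; apply in_seq in Hj || apply in_seq; lia.
  - apply polyhedron_forall_list. intros j Hj. apply in_seq in Hj. apply H; lia.
Qed.

Lemma polyhedron_preimage n m Q (phi : (nat -> R) -> nat -> R) :
  polyhedron n Q -> (forall k, (k < n)%nat -> aff m (fun x => phi x k)) ->
  polyhedron m (fun x => Q (phi x)).
Proof.
  intros [rows H] Hphi.
  apply polyhedron_ext with
    (fun x => forall r, In r rows -> lin n (fst r) (phi x) <= snd r).
  - intros x. symmetry. apply H.
  - apply polyhedron_forall_list. intros r _. apply polyhedron_le; [|apply aff_const].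
    apply (aff_rsum m n (fun k x => fst r k * phi x k)).
    intros k Hk. apply aff_scal; auto.
Qed.

(** Helly's theorem on the line: positive coefficients give upper bounds, negative ones lower
    bounds. The induction clips [t] to the new bound, and the pairwise hypothesis protects the
    earlier bounds of the opposite kind. *)
Lemma interval_nonempty {T} (a e : T -> R) (l : list T) :
  (forall r r', In r l -> In r' l -> 0 < a r -> a r' < 0 ->
     e r' / a r' <= e r / a r) ->
  exists t, forall r, In r l ->
    (0 < a r -> t <= e r / a r) /\ (a r < 0 -> e r / a r <= t).
Proof.
  induction l as [|r0 l IH]; intros H.
  - exists 0. intros r [].
  - destruct IH as [t Ht].
    { intros r r' Hr Hr'. apply H; simpl; auto. }
    destruct (Rtotal_order (a r0) 0) as [Hneg|[Hz|Hpos]].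
    + exists (Rmax t (e r0 / a r0)). intros r [<-|Hr]; split; intros Hs.
      * lra.
      * apply Rmax_r.
      * apply Rmax_lub; [apply Ht; auto|apply H; simpl; auto].
      * eapply Rle_trans; [apply Ht; auto|apply Rmax_l].
    + exists t. intros r [<-|Hr]; [lra|auto].
    + exists (Rmin t (e r0 / a r0)). intros r [<-|Hr]; split; intros Hs.
      * apply Rmin_r.
      * lra.
      * eapply Rle_trans; [apply Rmin_l|apply Ht; auto].
      * apply Rmin_glb; [apply Ht; auto|apply H; simpl; auto].
Qed.

Definition glue (m : nat) (x u : nat -> R) (k : nat) : R :=
  if (k <? m)%nat then x k else u (k - m)%nat.

Lemma glue_l m x u k : (k < m)%nat -> glue m x u k = x k.
Proof. intros H. unfold glue. destruct (Nat.ltb_spec k m); [auto|lia]. Qed.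

Lemma glue_r m x u k : glue m x u (m + k) = u k.
Proof.
  unfold glue. destruct (Nat.ltb_spec (m + k) m); [lia|].
  f_equal; lia.
Qed.

Lemma polyhedron_project1 n Q :
  polyhedron (S n) Q -> polyhedron n (fun x => exists t, Q (glue n x (fun _ => t))).
Proof.
  intros [rows H].
  set (e := fun (x : nat -> R) (r : (nat -> R) * R) => snd r - lin n (fst r) x).
  assert (Q1 : forall x t, Q (glue n x (fun _ => t)) <->
            forall r, In r rows -> fst r n * t <= e x r).
  { intros x t. rewrite H.
    assert (E : forall r : (nat -> R) * R, lin (S n) (fst r) (glue n x (fun _ => t)) =
                lin n (fst r) x + fst r n * t).
    { intros r. unfold lin; simpl. f_equal.
      - apply rsum_ext. intros k Hk. rewrite glue_l; auto.
      - unfold glue. rewrite Nat.ltb_irrefl. reflexivity. }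
    split; intros Hr r Hin; specialize (Hr r Hin); rewrite E in *; unfold e in *; lra. }
  assert (He : forall r, aff n (fun x => e x r)).
  { intros r. unfold e. apply aff_minus; [apply aff_const|].
    exists (fst r), 0. intros; lra. }
  (* The pair condition is [e x r' / fst r' n <= e x r / fst r n] multiplied by the negative product
     of the two coefficients, so that it is affine in [x]. *)
  apply polyhedron_ext with (fun x =>
    (forall r, In r rows -> fst r n = 0 -> 0 <= e x r) /\
    (forall r, In r rows -> forall r', In r' rows -> 0 < fst r n ->
       fst r' n < 0 -> fst r' n * e x r <= fst r n * e x r')).
  - intros x. split.
    + intros [Hz Hpn].
      destruct (interval_nonempty (fun r => fst r n) (e x) rows) as [t Ht].
      { intros r r' Hr Hr' Hp Hn. specialize (Hpn r Hr r' Hr' Hp Hn).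
        apply Rmult_le_reg_l with (fst r n * - fst r' n); [nra|].
        replace (fst r n * - fst r' n * (e x r' / fst r' n))
          with (- (fst r n * e x r')) by (field; lra).
        replace (fst r n * - fst r' n * (e x r / fst r n))
          with (- (fst r' n * e x r)) by (field; lra).
        lra. }
      exists t. apply Q1. intros r Hr. destruct (Ht r Hr) as [Hp Hn].
      destruct (Rtotal_order (fst r n) 0) as [Hlt|[Heq|Hgt]].
      * specialize (Hn Hlt).
        replace (e x r) with (fst r n * (e x r / fst r n)) by (field; lra). nra.
      * rewrite Heq. specialize (Hz r Hr Heq). lra.
      * specialize (Hp Hgt).
        replace (e x r) with (fst r n * (e x r / fst r n)) by (field; lra). nra.
    + intros [t Ht]. rewrite Q1 in Ht. split.
      * intros r Hr Hz. specialize (Ht r Hr). rewrite Hz in Ht. lra.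
      * intros r Hr r' Hr' Hp Hn. pose proof (Ht r Hr). pose proof (Ht r' Hr').
        nra.
  - apply polyhedron_and.
    + apply polyhedron_forall_list. intros r _. apply polyhedron_imp. intros _.
      apply polyhedron_le; [apply aff_const|apply He].
    + apply polyhedron_forall_list. intros r _. apply polyhedron_forall_list. intros r' _.
      apply polyhedron_imp; intros _. apply polyhedron_imp; intros _.
      apply polyhedron_le; apply aff_scal; apply He.
Qed.

Lemma polyhedron_project m p Q :
  polyhedron (m + p) Q -> polyhedron m (fun x => exists u, Q (glue m x u)).
Proof.
  revert Q. induction p as [|p IH]; intros Q HQ.
  - rewrite Nat.add_0_r in HQ. apply polyhedron_ext with Q; [|auto].
    intros x; split.
    + intros Hx. exists (fun _ => 0). apply (polyhedron_coords m Q x); auto.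
      intros k Hk. rewrite glue_l; auto.
    + intros [u Hu]. apply (polyhedron_coords m Q (glue m x u)); auto.
      intros k Hk. rewrite glue_l; auto.
  - assert (HQ' := HQ). rewrite Nat.add_succ_r in HQ'.
    eapply polyhedron_ext; [|exact (IH _ (polyhedron_project1 _ _ HQ'))].
    intros x; split.
    + intros [u [t Hu]]. exists (glue p u (fun _ => t)).
      eapply polyhedron_coords; [exact HQ| |exact Hu].
      intros k Hk. unfold glue.
      destruct (Nat.ltb_spec k (m + p)), (Nat.ltb_spec k m),
        (Nat.ltb_spec (k - m) p); lia || reflexivity.
    + intros [u Hu]. exists u, (u p).
      eapply polyhedron_coords; [exact HQ| |exact Hu].
      intros k Hk. unfold glue.
      destruct (Nat.ltb_spec k (m + p)), (Nat.ltb_spec k m);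
        lia || reflexivity || (f_equal; lia).
Qed.

(** Each row is Lipschitz in the sup norm, with the sum [K] of its absolute coefficients as
    constant. The tolerance [eps / (K + 1)] also covers a zero row. *)
Lemma polyhedron_closed n Q x :
  polyhedron n Q ->
  (forall eps, 0 < eps ->
     exists x', Q x' /\ forall k, (k < n)%nat -> Rabs (x' k - x k) <= eps) ->
  Q x.
Proof.
  intros [rows H] Hcl. apply H. intros r Hr.
  set (a := fst r). set (K := rsum n (fun k => Rabs (a k))).
  assert (HK : 0 <= K) by (apply rsum_nonneg; intros; apply Rabs_pos).
  apply le_epsilon. intros eps Heps.
  destruct (Hcl (eps / (K + 1))) as [x' [Hx' Hd]].
  { apply Rdiv_lt_0_compat; lra. }
  apply H with (r := r) in Hx'; auto. fold a in Hx' |- *.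
  assert (D : lin n a x - lin n a x' <= K * (eps / (K + 1))).
  { unfold lin, K. rewrite <- rsum_minus, Rmult_comm, <- rsum_scal.
    apply rsum_le. intros k Hk. specialize (Hd k Hk).
    replace (a k * x k - a k * x' k) with (a k * (x k - x' k)) by ring.
    eapply Rle_trans; [apply Rle_abs|].
    rewrite Rabs_mult, Rabs_minus_sym, Rmult_comm.
    apply Rmult_le_compat_r; [apply Rabs_pos|auto]. }
  assert (K * (eps / (K + 1)) <= eps).
  { apply Rmult_le_reg_r with (K + 1); [lra|]. field_simplify; nra. }
  lra.
Qed.

(** * The convex hull of a bounded mixed-integer set is polyhedral *)

(** Members of [inX] and [inconv] vanish from [dim] on, while a polyhedron ignores those
    coordinates; truncation reconciles the two conventions. *)
Definition trunc (d : nat) (x : nat -> R) (k : nat) : R :=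
  if (k <? d)%nat then x k else 0.

Lemma trunc_lt d x k : (k < d)%nat -> trunc d x k = x k.
Proof. intros H. unfold trunc. destruct (Nat.ltb_spec k d); [auto|lia]. Qed.

Lemma trunc_id d x : (forall k, (d <= k)%nat -> x k = 0) -> trunc d x = x.
Proof.
  intros H. apply functional_extensionality. intros k. unfold trunc.
  destruct (Nat.ltb_spec k d); [auto|symmetry; auto].
Qed.

(* Homogenization of the slice of [X_i] with integer part [g]; the coordinate
   [dim i] is the scaling factor. *)
Definition slice_cone (P : milp_data) (i : nat) (g e : nat -> R) : Prop :=
  0 <= e (dim P i) /\
  (forall k, (k < nZ P i)%nat -> e k = g k * e (dim P i)) /\
  (forall j, (j < nloc P i)%nat ->
     rsum (dim P i) (fun k => Dloc P i j k * e k) <= dloc P i j * e (dim P i)).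

(** The Minkowski sum of the slice cones, with one summand split off at a time so that each costs
    one projection. The [nil] case constrains only the coordinates that a polyhedron of this
    dimension can see. *)
Fixpoint cone_sum (P : milp_data) (i : nat) (G : list (nat -> R)) (e : nat -> R)
  : Prop :=
  match G with
  | nil => forall k, (k < S (dim P i))%nat -> e k = 0
  | g :: G' => exists u, slice_cone P i g u /\ cone_sum P i G' (fun k => e k - u k)
  end.

Lemma slice_cone_polyhedron P i g : polyhedron (S (dim P i)) (slice_cone P i g).
Proof.
  assert (nZ P i <= dim P i)%nat by (unfold dim; lia).
  unfold slice_cone. apply polyhedron_and; [|apply polyhedron_and].
  - apply polyhedron_le; [apply aff_const|apply aff_coord; lia].
  - apply polyhedron_forall_lt. intros j Hj. apply polyhedron_eq.
    + apply aff_coord; lia.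
    + apply aff_scal, aff_coord; lia.
  - apply polyhedron_forall_lt. intros j Hj. apply polyhedron_le.
    + apply (aff_rsum _ _ (fun k e => Dloc P i j k * e k)). intros k Hk.
      apply aff_scal, aff_coord; lia.
    + apply aff_scal, aff_coord; lia.
Qed.

Lemma cone_sum_polyhedron P i G : polyhedron (S (dim P i)) (cone_sum P i G).
Proof.
  set (m := S (dim P i)).
  induction G as [|g G IH]; simpl.
  - apply polyhedron_forall_lt. intros k Hk. apply polyhedron_eq.
    + apply aff_coord; auto.
    + apply aff_const.
  - eapply polyhedron_ext.
    (* The summand [u] is stored in the coordinates from [m] to [m + m] and projected away. *)
    2: { apply (polyhedron_project m m (fun e => slice_cone P i g (fun k => e (m + k)%nat) /\
            cone_sum P i G (fun k => e k - e (m + k)%nat))).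
         apply polyhedron_and.
         - apply (polyhedron_preimage m (m + m) _ (fun e k => e (m + k)%nat)).
           + apply slice_cone_polyhedron.
           + intros k Hk. apply aff_coord; lia.
         - apply (polyhedron_preimage m (m + m) _ (fun e k => e k - e (m + k)%nat)); auto.
           intros k Hk. apply aff_minus; apply aff_coord; lia. }
    intros x. cbv beta. split; intros [u [H1 H2]]; exists u; split.
    + eapply polyhedron_coords; [apply slice_cone_polyhedron| |exact H1].
      intros k _. cbv beta. apply glue_r.
    + eapply polyhedron_coords; [exact IH| |exact H2].
      intros k Hk. cbv beta. rewrite glue_r, glue_l; auto.
    + eapply polyhedron_coords; [apply slice_cone_polyhedron| |exact H1].
      intros k _. cbv beta. rewrite glue_r; auto.
    + eapply polyhedron_coords; [exact IH| |exact H2].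
      intros k Hk. cbv beta. rewrite glue_r, glue_l; auto.
Qed.

Lemma slice_cone_plus P i g e e' :
  slice_cone P i g e -> slice_cone P i g e' ->
  slice_cone P i g (fun k => e k + e' k).
Proof.
  intros [H1 [H2 H3]] [H1' [H2' H3']]. split; [lra|split].
  - intros k Hk. rewrite H2, H2'; auto; lra.
  - intros j Hj. specialize (H3 j Hj). specialize (H3' j Hj).
    rewrite rsum_ext with (g := fun k => Dloc P i j k * e k + Dloc P i j k * e' k)
      by (intros; lra).
    rewrite rsum_plus. lra.
Qed.

Lemma slice_cone_zero P i g : slice_cone P i g (fun _ => 0).
Proof.
  split; [lra|split]; intros; [lra|]. rewrite rsum_zero; intros; lra.
Qed.

Lemma cone_sum_plus P i G e e' :
  cone_sum P i G e -> cone_sum P i G e' -> cone_sum P i G (fun k => e k + e' k).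
Proof.
  revert e e'. induction G as [|g G IH]; simpl; intros e e' H H'.
  - intros k Hk. rewrite H, H'; auto; lra.
  - destruct H as [u [Hu H]], H' as [u' [Hu' H']].
    exists (fun k => u k + u' k). split; [apply slice_cone_plus; auto|].
    replace (fun k => e k + e' k - (u k + u' k))
      with (fun k => (e k - u k) + (e' k - u' k)).
    + apply (IH _ _ H H').
    + apply functional_extensionality; intros k; ring.
Qed.

Lemma cone_sum_zero P i G : cone_sum P i G (fun _ => 0).
Proof.
  induction G as [|g G IH]; simpl; [auto|].
  exists (fun _ => 0). split; [apply slice_cone_zero|].
  replace (fun _ : nat => 0 - 0) with (fun _ : nat => 0); auto.
  apply functional_extensionality; intros; ring.
Qed.

Lemma slice_cone_sum P i G g e :
  In g G -> slice_cone P i g e -> cone_sum P i G e.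
Proof.
  revert e. induction G as [|g' G IH]; simpl; intros e Hin H; [tauto|].
  destruct Hin as [->|Hin].
  - exists e. split; auto.
    replace (fun k => e k - e k) with (fun _ : nat => 0); [apply cone_sum_zero|].
    apply functional_extensionality; intros; ring.
  - exists (fun _ => 0). split; [apply slice_cone_zero|].
    replace (fun k => e k - 0) with e; auto.
    apply functional_extensionality; intros; ring.
Qed.

(** The cone over conv(X_i), the coordinate [dim P i] being the height; its section at height 1 is
    the hull, and the empty combination is its apex. *)
Definition conic_comb (P : milp_data) (i : nat) (e : nat -> R) : Prop :=
  exists (p : nat) (w : nat -> R) (xs : nat -> nat -> R),
    (forall j, (j < p)%nat -> 0 <= w j /\ inX P i (xs j)) /\
    rsum p w = e (dim P i) /\
    (forall k, (k < dim P i)%nat -> e k = rsum p (fun j => w j * xs j k)).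

Lemma conic_comb_plus P i e e' :
  conic_comb P i e -> conic_comb P i e' -> conic_comb P i (fun k => e k + e' k).
Proof.
  intros [p [w [xs [H1 [H2 H3]]]]] [p' [w' [xs' [H1' [H2' H3']]]]].
  assert (Hl : forall T (f f' : nat -> T) j, (j < p)%nat ->
            (if (j <? p)%nat then f j else f' (j - p)%nat) = f j).
  { intros T f f' j Hj. destruct (Nat.ltb_spec j p); [auto|lia]. }
  assert (Hr : forall T (f f' : nat -> T) j,
            (if (p + j <? p)%nat then f (p + j)%nat else f' (p + j - p)%nat) = f' j).
  { intros T f f' j. destruct (Nat.ltb_spec (p + j) p); [lia|f_equal; lia]. }
  exists (p + p')%nat, (fun j => if (j <? p)%nat then w j else w' (j - p)%nat),
    (fun j => if (j <? p)%nat then xs j else xs' (j - p)%nat).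
  split; [|split].
  - intros j Hj. destruct (Nat.ltb_spec j p); [auto|]. apply H1'; lia.
  - rewrite rsum_app.
    rewrite (rsum_ext p _ w) by (intros; apply (Hl R w w'); auto).
    rewrite (rsum_ext p' _ w') by (intros; apply (Hr R w w')).
    lra.
  - intros k Hk. rewrite rsum_app.
    rewrite (rsum_ext p _ (fun j => w j * xs j k))
      by (intros; rewrite (Hl R w w'), (Hl _ xs xs'); auto).
    rewrite (rsum_ext p' _ (fun j => w' j * xs' j k))
      by (intros; rewrite (Hr R w w'), (Hr _ xs xs'); auto).
    rewrite H3, H3'; auto.
Qed.

(** A direction without integer part that satisfies the homogeneous system keeps a point of X_i
    inside X_i along a whole ray, which boundedness forbids unless it is zero. *)
Lemma recession_trivial P i u :
  (exists x, inX P i x) ->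
  (exists B, forall x, inX P i x -> forall k, Rabs (x k) <= B) ->
  (forall k, (k < nZ P i)%nat -> u k = 0) ->
  (forall j, (j < nloc P i)%nat ->
     rsum (dim P i) (fun k => Dloc P i j k * u k) <= 0) ->
  forall k, (k < dim P i)%nat -> u k = 0.
Proof.
  intros [x [Hx1 [Hx2 Hx3]]] [B HB] Hz Hl k Hk.
  assert (Hray : forall t, 0 <= t -> Rabs (x k + t * u k) <= B).
  { intros t Ht.
    replace (x k + t * u k) with (x k + t * trunc (dim P i) u k)
      by (rewrite trunc_lt; auto).
    apply (HB (fun k => x k + t * trunc (dim P i) u k)). split; [|split].
    - intros l Hl'. rewrite Hx1; auto. unfold trunc.
      destruct (Nat.ltb_spec l (dim P i)); [lia|lra].
    - intros l Hl'. destruct (Hx2 l Hl') as [z Hz']. exists z.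
      rewrite trunc_lt, Hz; [lra|auto|unfold dim; lia].
    - intros j Hj. specialize (Hx3 j Hj). specialize (Hl j Hj).
      rewrite rsum_ext with
        (g := fun k => Dloc P i j k * x k + t * (Dloc P i j k * u k)).
      + rewrite rsum_plus, rsum_scal. nra.
      + intros l Hl'. rewrite trunc_lt; auto. ring. }
  destruct (Req_dec (u k) 0) as [|Hne]; [auto|exfalso].
  assert (Hpos : 0 < Rabs (u k)) by (apply Rabs_pos_lt; auto).
  pose proof (Hray 0 (Rle_refl 0)) as H0. rewrite Rmult_0_l, Rplus_0_r in H0.
  assert (HBp : 0 <= B) by (pose proof (Rabs_pos (x k)); lra).
  (* Two points of X_i differ by at most [2 * B] in a coordinate; this [t] moves coordinate [k] by
     [2 * B + 1]. *)
  set (t := (2 * B + 1) / Rabs (u k)).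
  assert (Ht : 0 <= t) by (apply Rlt_le, Rdiv_lt_0_compat; lra).
  pose proof (Hray t Ht) as H1.
  assert (Ht' : Rabs (t * u k) = 2 * B + 1).
  { rewrite Rabs_mult, (Rabs_pos_eq t); auto. unfold t. field. lra. }
  pose proof (Rabs_triang (x k + t * u k) (- x k)) as H2.
  rewrite Rabs_Ropp in H2.
  replace (x k + t * u k + - x k) with (t * u k) in H2 by ring. lra.
Qed.

(** At positive height, rescaling to height 1 yields a point of X_i. At height zero, [e] is a
    recession direction and hence vanishes. In particular, an integral [g] with an empty slice
    contributes only the apex. *)
Lemma slice_cone_conic P i g e :
  (exists x, inX P i x) ->
  (exists B, forall x, inX P i x -> forall k, Rabs (x k) <= B) ->
  (forall k, (k < nZ P i)%nat -> exists z : Z, g k = IZR z) ->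
  slice_cone P i g e -> conic_comb P i e.
Proof.
  intros Hne Hbd Hg [H1 [H2 H3]].
  set (d := dim P i) in *.
  destruct (Req_dec (e d) 0) as [Hz|Hnz].
  - exists 0%nat, (fun _ => 0), (fun _ _ => 0). split; [intros; lia|]. simpl.
    split; [symmetry; apply Hz|].
    apply recession_trivial; auto.
    + intros k Hk. rewrite H2, Hz; auto; lra.
    + intros j Hj. specialize (H3 j Hj). rewrite Hz in H3. unfold d in H3. lra.
  - exists 1%nat, (fun _ => e d), (fun _ => trunc d (fun k => / e d * e k)).
    simpl. split; [|split].
    + intros _ _. split; auto. split; [|split].
      * intros k Hk. unfold trunc. destruct (Nat.ltb_spec k d); [|auto].
        unfold d in *; lia.
      * intros k Hk. destruct (Hg k Hk) as [z Hz]. exists z.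
        rewrite trunc_lt; [|unfold d, dim; lia].
        rewrite (H2 k Hk), Hz. field; auto.
      * intros j Hj. specialize (H3 j Hj). fold d.
        rewrite rsum_ext with (g := fun k => / e d * (Dloc P i j k * e k)).
        -- rewrite rsum_scal. apply Rmult_le_reg_l with (e d); [lra|].
           rewrite <- Rmult_assoc, Rinv_r; auto. lra.
        -- intros k Hk. rewrite trunc_lt; auto. ring.
    + fold d. lra.
    + intros k Hk. rewrite trunc_lt; auto. field; auto.
Qed.

Lemma cone_sum_conic P i G e :
  (exists x, inX P i x) ->
  (exists B, forall x, inX P i x -> forall k, Rabs (x k) <= B) ->
  (forall g, In g G -> forall k, (k < nZ P i)%nat -> exists z : Z, g k = IZR z) ->
  cone_sum P i G e -> conic_comb P i e.
Proof.
  intros Hne Hbd. revert e. induction G as [|g G IH]; simpl; intros e HG H.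
  - exists 0%nat, (fun _ => 0), (fun _ _ => 0). split; [intros; lia|]. simpl.
    split; [|intros; apply H]; [rewrite H|]; auto; lia.
  - destruct H as [u [Hu H]].
    replace e with (fun k => u k + (e k - u k)).
    + apply conic_comb_plus; [|apply IH; auto].
      apply slice_cone_conic with g; auto.
    + apply functional_extensionality; intros; ring.
Qed.

Lemma integers_bounded (B : R) :
  exists l : list R, (forall r, In r l -> exists z : Z, r = IZR z) /\
    forall z : Z, Rabs (IZR z) <= B -> In (IZR z) l.
Proof.
  set (K := Z.to_nat (up B)).
  exists (map (fun j => IZR (Z.of_nat j - Z.of_nat K)) (seq 0 (2 * K + 1))).
  split.
  - intros r Hr. apply in_map_iff in Hr. destruct Hr as [j [<- _]]. eauto.
  - intros z Hz. apply in_map_iff.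
    assert (Hz' : (Z.abs z < up B)%Z).
    { apply lt_IZR. rewrite abs_IZR. destruct (archimed B). lra. }
    exists (Z.to_nat (z + Z.of_nat K)). split.
    + f_equal. lia.
    + apply in_seq. lia.
Qed.

(** Boundedness leaves finitely many candidate integer parts, so a finite disjunction of slices
    describes X_i. Candidates with an empty slice are harmless. *)
Lemma integer_box (n : nat) (B : R) :
  exists G : list (nat -> R),
    (forall g, In g G -> forall k, (k < n)%nat -> exists z : Z, g k = IZR z) /\
    (forall x : nat -> R,
       (forall k, (k < n)%nat -> Rabs (x k) <= B /\ exists z : Z, x k = IZR z) ->
       exists g, In g G /\ forall k, (k < n)%nat -> x k = g k).
Proof.
  destruct (integers_bounded B) as [l [Hl1 Hl2]].
  induction n as [|n [G [HG1 HG2]]].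
  - exists ((fun _ => 0) :: nil). split; [intros; lia|].
    intros x _. exists (fun _ => 0). split; [simpl; auto|intros; lia].
  - exists (flat_map (fun g => map (fun r k => if (k =? n)%nat then r else g k) l) G).
    split.
    + intros g Hg k Hk. apply in_flat_map in Hg. destruct Hg as [g' [Hg' Hg]].
      apply in_map_iff in Hg. destruct Hg as [r [<- Hr]].
      destruct (Nat.eqb_spec k n); [auto|]. apply HG1; auto; lia.
    + intros x Hx. destruct (HG2 x) as [g [Hg Hgx]].
      { intros k Hk. apply Hx; lia. }
      exists (fun k => if (k =? n)%nat then x n else g k). split.
      * apply in_flat_map. exists g. split; auto.
        apply (in_map (fun r k => if (k =? n)%nat then r else g k)).
        destruct (Hx n) as [HB [z Hz]]; [lia|]. rewrite Hz in *. auto.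
      * intros k Hk. destruct (Nat.eqb_spec k n) as [->|]; [auto|].
        apply Hgx; lia.
Qed.

Lemma inconv_dim P i z : inconv P i z -> forall k, (dim P i <= k)%nat -> z k = 0.
Proof.
  intros [p [w [xs [H1 [H2 H3]]]]] k Hk. rewrite H3. apply rsum_zero.
  intros j Hj. destruct (H1 j Hj) as [_ [Hx _]]. rewrite Hx; auto; lra.
Qed.

(* Balas' disjunctive formulation: the hull of the union of the slices is the
   section at scaling factor 1 of the sum of their homogenizations. *)
Lemma inconv_polyhedron P i :
  (exists x, inX P i x) ->
  (exists B, forall x, inX P i x -> forall k, Rabs (x k) <= B) ->
  polyhedron (dim P i) (fun z => inconv P i (trunc (dim P i) z)).
Proof.
  intros Hne Hbd. set (d := dim P i).
  destruct Hbd as [B HB]. destruct (integer_box (nZ P i) B) as [G [HG1 HG2]].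
  apply polyhedron_ext with
    (fun z => cone_sum P i G (fun k => if (k <? d)%nat then z k else 1)).
  2: { apply (polyhedron_preimage (S d) d _ (fun z k => if (k <? d)%nat then z k else 1)).
       - apply cone_sum_polyhedron.
       - intros k Hk. destruct (Nat.ltb_spec k d).
         + apply aff_coord; auto.
         + apply aff_const. }
  assert (HnZ : (nZ P i <= d)%nat) by (unfold d, dim; lia).
  intros z. split.
  - intros H. apply cone_sum_conic in H; eauto.
    destruct H as [p [w [xs [H1 [H2 H3]]]]]. exists p, w, xs.
    split; [auto|split].
    + rewrite H2. fold d. rewrite Nat.ltb_irrefl. reflexivity.
    + intros k. unfold trunc. destruct (Nat.ltb_spec k d) as [Hk|Hk].
      * rewrite <- H3 by auto. destruct (Nat.ltb_spec k d); [auto|lia].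
      * symmetry. apply rsum_zero. intros j Hj.
        destruct (H1 j Hj) as [_ [Hx _]]. rewrite Hx; auto; lra.
  - intros [p [w [xs [H1 [H2 H3]]]]].
    (* Each lifted generator [w j * (xs j, 1)] lies in the cone of its own slice; they are added one
       by one. *)
    assert (Hsum : forall q, (q <= p)%nat -> cone_sum P i G (fun k =>
               rsum q (fun j => w j * (if (k <? d)%nat then xs j k else 1)))).
    { induction q as [|q IH]; intros Hq; simpl; [apply cone_sum_zero|].
      apply (cone_sum_plus P i G
        (fun k => rsum q (fun j => w j * (if (k <? d)%nat then xs j k else 1)))
        (fun k => w q * (if (k <? d)%nat then xs q k else 1)));
        [apply IH; lia|].
      destruct (H1 q) as [Hw [Hx1 [Hx2 Hx3]]]; [lia|].
      destruct (HG2 (xs q)) as [g [Hg Hgx]].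
      { intros k Hk. split; [|auto]. apply HB. repeat split; auto. }
      apply slice_cone_sum with g; auto. unfold slice_cone. fold d.
      rewrite Nat.ltb_irrefl. split; [lra|split].
      - intros k Hk. destruct (Nat.ltb_spec k d); [|lia]. rewrite Hgx; auto; ring.
      - intros j Hj. specialize (Hx3 j Hj).
        rewrite rsum_ext with (g := fun k => w q * (Dloc P i j k * xs q k)).
        + rewrite rsum_scal. fold d in Hx3. nra.
        + intros k Hk. destruct (Nat.ltb_spec k d); [ring|lia]. }
    eapply polyhedron_coords; [apply cone_sum_polyhedron| |exact (Hsum p (Nat.le_refl p))].
    intros k Hk. cbv beta. destruct (Nat.ltb_spec k d) as [Hkd|Hkd].
    + rewrite <- H3, trunc_lt; auto.
    + rewrite rsum_ext with (g := w); [auto|intros; ring].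
Qed.

(** The family [F] is left free because two attainable sets are needed: total resources with cost
    for the exact penalty, and the resources of each agent with the total cost for the limit
    allocation. *)
Lemma joint_projection_polyhedron P (m : nat) (F : nat -> nat -> nat -> R) :
  local_sets_ok P ->
  polyhedron m (fun x => exists z,
    (forall i, (i < nag P)%nat -> inconv P i (z i)) /\
    (forall j, (j < m)%nat ->
       rsum (nag P) (fun i => rsum (dim P i) (fun k => F j i k * z i k)) <= x j)).
Proof.
  intros Hok.
  assert (HD : exists D, forall i, (i < nag P)%nat -> (dim P i <= D)%nat).
  { clear Hok F. induction (nag P) as [|n [D HD]]; [exists 0%nat; lia|].
    exists (D + dim P n)%nat. intros i Hi.
    destruct (Nat.eq_dec i n) as [->|]; [lia|].
    assert (dim P i <= D)%nat by (apply HD; lia). lia. }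
  destruct HD as [D HD]. set (N := nag P) in *.
  assert (Hidx : forall i k, (i < N)%nat -> (k < dim P i)%nat ->
            (m + (i * D + k) < m + N * D)%nat).
  { intros i k Hi Hk. specialize (HD i Hi). nia. }
  (* All blocks are packed behind [x] in one vector, with a common stride [D] that is at least every
     block dimension. *)
  set (Z := fun (e : nat -> R) i => trunc (dim P i) (fun k => e (m + (i * D + k))%nat)).
  assert (HZ : polyhedron (m + N * D) (fun e =>
    (forall i, (i < N)%nat -> inconv P i (Z e i)) /\
    (forall j, (j < m)%nat ->
      rsum N (fun i => rsum (dim P i) (fun k => F j i k * Z e i k)) <= e j))).
  { apply polyhedron_and; apply polyhedron_forall_lt.
    - intros i Hi. destruct (Hok i Hi) as [Hne Hbd].
      apply (polyhedron_preimage (dim P i) _ (fun z => inconv P i (trunc (dim P i) z))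
               (fun e k => e (m + (i * D + k))%nat)).
      + apply inconv_polyhedron; auto.
      + intros k Hk. apply aff_coord; auto.
    - intros j Hj. apply polyhedron_le; [|apply aff_coord; lia].
      apply (aff_rsum _ _ (fun i e => rsum (dim P i) (fun k => F j i k * Z e i k))).
      intros i Hi.
      apply (aff_rsum _ _ (fun k e => F j i k * Z e i k)).
      intros k Hk. apply aff_scal. unfold Z, trunc.
      destruct (k <? dim P i)%nat; [apply aff_coord; auto|apply aff_const]. }
  eapply polyhedron_ext; [|exact (polyhedron_project _ _ _ HZ)].
  intros x. cbv beta. split.
  - intros [u [H1 H2]]. exists (Z (glue m x u)). split; auto.
    intros j Hj. rewrite <- (glue_l m x u j) by auto. auto.
  - intros [z [H1 H2]].
    exists (fun q => z (q / D)%nat (q mod D)%nat).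
    assert (HZz : forall i, (i < N)%nat ->
      Z (glue m x (fun q => z (q / D)%nat (q mod D)%nat)) i = z i).
    { intros i Hi. rewrite <- (trunc_id (dim P i) (z i)) by (apply inconv_dim; auto).
      apply functional_extensionality. intros k. unfold Z, trunc.
      destruct (Nat.ltb_spec k (dim P i)) as [Hk|Hk]; [|auto].
      rewrite glue_r. specialize (HD i Hi).
      rewrite Nat.div_add_l, Nat.div_small by lia.
      rewrite (Nat.add_comm (i * D)), Nat.Div0.mod_add, Nat.mod_small by lia.
      rewrite Nat.add_0_r. reflexivity. }
    split.
    + intros i Hi. rewrite HZz; auto.
    + intros j Hj. rewrite glue_l by auto.
      rewrite rsum_ext with
        (g := fun i => rsum (dim P i) (fun k => F j i k * z i k)); [auto|].
      intros i Hi. rewrite HZz; auto.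
Qed.

Lemma finite_bound (n : nat) (Q : nat -> R -> Prop) :
  (forall i B B', B <= B' -> Q i B -> Q i B') ->
  (forall i, (i < n)%nat -> exists B, Q i B) ->
  exists B, 0 <= B /\ forall i, (i < n)%nat -> Q i B.
Proof.
  intros Hmono. induction n as [|n IH]; intros H.
  - exists 0. split; [lra|intros; lia].
  - destruct IH as [B [HB1 HB2]]; [auto|].
    destruct (H n) as [B' HB']; [lia|].
    exists (Rmax B B'). pose proof (Rmax_l B B'). pose proof (Rmax_r B B').
    split; [lra|]. intros i Hi. destruct (Nat.eq_dec i n) as [->|].
    + apply Hmono with B'; auto.
    + apply Hmono with B; auto. apply HB2; lia.
Qed.

(** * Exact penalty *)

(** Only a row with a negative coefficient can stop [v] from decreasing. Applied to the cost at an
    optimum, slack would give a cheaper point, so a supporting row exists; it plays the role of a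
    dual solution. *)
Lemma tight_or_slack {T} (b e : T -> R) (v : R) (l : list T) :
  (forall r, In r l -> b r * v <= e r) ->
  (exists r, In r l /\ b r < 0 /\ b r * v = e r) \/
  (exists delta, 0 < delta /\ forall r, In r l -> b r * (v - delta) <= e r).
Proof.
  induction l as [|r0 l IH]; intros H.
  - right. exists 1. split; [lra|intros r []].
  - destruct IH as [[r [Hr Hr']]|[delta [Hd Hl]]].
    { intros r Hr. apply H; simpl; auto. }
    { left. exists r. simpl; auto. }
    assert (H0 := H r0 (or_introl eq_refl)).
    destruct (Rlt_dec (b r0) 0) as [Hneg|Hpos].
    + destruct (Req_dec (b r0 * v) (e r0)) as [Heq|Hne].
      { left. exists r0. simpl; auto. }
      right. set (d0 := (e r0 - b r0 * v) / - b r0).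
      assert (Hd0 : 0 < d0) by (apply Rdiv_lt_0_compat; lra).
      assert (Hd0' : - b r0 * d0 = e r0 - b r0 * v) by (unfold d0; field; lra).
      pose proof (Rmin_l delta d0). pose proof (Rmin_r delta d0).
      exists (Rmin delta d0). split; [apply Rmin_pos; auto|].
      intros r [<-|Hr]; [nra|].
      assert (Hv := H r (or_intror Hr)). specialize (Hl r Hr).
      assert (0 < Rmin delta d0) by (apply Rmin_pos; auto).
      destruct (Rle_dec 0 (b r)); nra.
    + right. exists delta. split; auto. intros r [<-|Hr]; [nra|auto].
Qed.

(** One scalar [w] relaxes every constraint equally, since the sum of the agents' [v] will take its
    place. The supporting row at (b - r, optimal cost) bounds the gain linearly in [w]. *)
Lemma exact_penalty P r zs :
  local_sets_ok P -> lpr_optimal P r zs ->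
  exists M0, 0 <= M0 /\ forall z w,
    (forall i, (i < nag P)%nat -> inconv P i (z i)) -> 0 <= w ->
    (forall s, (s < ncon P)%nat ->
       rsum (nag P) (fun i => Ax P i s (z i)) <= bcoup P s - r s + w) ->
    lpr_obj P zs <= lpr_obj P z + M0 * w.
Proof.
  intros Hok [[Hs1 Hs2] Hopt].
  set (m := ncon P). set (opt := lpr_obj P zs).
  destruct (joint_projection_polyhedron P (S m)
    (fun j i k => if (j <? m)%nat then Acoup P i j k else cost P i k) Hok)
    as [rows Hrows].
  set (x := fun (q : nat -> R) (v : R) (j : nat) => if (j <? m)%nat then q j else v).
  assert (Hlin : forall a q v, lin (S m) a (x q v) = lin m a q + a m * v).
  { intros a q v. unfold lin. simpl. f_equal.
    - apply rsum_ext. intros k Hk. unfold x. destruct (Nat.ltb_spec k m); [auto|lia].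
    - unfold x. rewrite Nat.ltb_irrefl. auto. }
  assert (Hmem : forall q v,
    (exists z, (forall i, (i < nag P)%nat -> inconv P i (z i)) /\
       (forall s, (s < m)%nat -> rsum (nag P) (fun i => Ax P i s (z i)) <= q s) /\
       lpr_obj P z <= v) <->
    forall r, In r rows -> lin m (fst r) q + fst r m * v <= snd r).
  { intros q v. specialize (Hrows (x q v)). split.
    - intros [z [H1 [H2 H3]]] r' Hr'. rewrite <- Hlin. revert r' Hr'.
      apply Hrows. exists z. split; auto. intros j Hj. unfold x.
      destruct (Nat.ltb_spec j m); [apply H2; auto|exact H3].
    - intros H. destruct Hrows as [_ Hrows]. destruct Hrows as [z [H1 H2]].
      { intros r' Hr'. rewrite Hlin. auto. }
      exists z. split; [auto|split].
      + intros s Hs. specialize (H2 s). unfold x in H2.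
        destruct (Nat.ltb_spec s m); [apply H2; lia|lia].
      + specialize (H2 m). unfold x in H2. rewrite Nat.ltb_irrefl in H2.
        apply H2; lia. }
  set (q0 := fun s => bcoup P s - r s).
  assert (Hopt0 : forall r, In r rows -> lin m (fst r) q0 + fst r m * opt <= snd r).
  { apply Hmem. exists zs. split; [auto|split]; [exact Hs2|apply Rle_refl]. }
  destruct (tight_or_slack (fun r => fst r m) (fun r => snd r - lin m (fst r) q0)
              opt rows) as [[r0 [Hr0 [Hneg Htight]]]|[delta [Hd Hslack]]].
  - intros r' Hr'. specialize (Hopt0 r' Hr'). lra.
  - set (A := rsum m (fst r0)).
    (* Relaxing every resource by [w] shifts the left side of the tight row by [w * A]; dividing by
       minus its cost coefficient converts the shift into cost. *)
    exists (Rabs A / - fst r0 m). split.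
    { apply Rmult_le_pos; [apply Rabs_pos|].
      apply Rlt_le, Rinv_0_lt_compat; lra. }
    intros z w Hz Hw Hc.
    assert (Hin : lin m (fst r0) (fun s => q0 s + w) + fst r0 m * lpr_obj P z <= snd r0).
    { apply Hmem; [|auto]. exists z. split; [auto|split]; [|apply Rle_refl].
      intros s Hs. unfold q0. apply Hc; auto. }
    assert (Hq : lin m (fst r0) (fun s => q0 s + w) = lin m (fst r0) q0 + w * A).
    { unfold lin, A. rewrite <- rsum_scal, <- rsum_plus.
      apply rsum_ext; intros; ring. }
    rewrite Hq in Hin.
    assert (HA : - (w * A) <= w * Rabs A).
    { pose proof (Rle_abs (- A)). rewrite Rabs_Ropp in *. nra. }
    apply Rmult_le_reg_l with (- fst r0 m); [lra|].
    replace (- fst r0 m * (lpr_obj P z + Rabs A / - fst r0 m * w))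
      with (- fst r0 m * lpr_obj P z + w * Rabs A) by (field; lra).
    nra.
  - exfalso.
    assert (Hin : exists z, (forall i, (i < nag P)%nat -> inconv P i (z i)) /\
       (forall s, (s < m)%nat -> rsum (nag P) (fun i => Ax P i s (z i)) <= q0 s) /\
       lpr_obj P z <= opt - delta).
    { apply Hmem. intros r' Hr'. specialize (Hslack r' Hr'). lra. }
    destruct Hin as [z [H1 [H2 H3]]].
    assert (opt <= lpr_obj P z) by (apply Hopt; split; auto). lra.
Qed.

(** * Bounded Laplacian on a connected graph *)

Definition laplacian (N : nat) (adj : nat -> nat -> bool) (m : nat -> R) (i : nat)
  : R := rsum N (fun j => if adj i j then m i - m j else 0).

(** Exchanging the endpoints of an edge flips the sign of its term. This conservation law keeps the
    total allocation at b - r. *)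
Lemma laplacian_sum_zero N adj m :
  (forall i j, adj i j = adj j i) -> rsum N (laplacian N adj m) = 0.
Proof.
  intros Hsym. set (T := rsum N (laplacian N adj m)).
  assert (T = - T); [|lra].
  unfold T at 1, laplacian. rewrite rsum_swap.
  replace (- T) with (-1 * T) by ring. unfold T. rewrite <- rsum_scal.
  apply rsum_ext. intros i Hi. unfold laplacian. rewrite <- rsum_scal.
  apply rsum_ext. intros j Hj. rewrite Hsym. destruct (adj i j); ring.
Qed.

(** Summation by parts: the two orientations of an edge add up to a square and [c] cancels. The
    choice [c = m O] will bring in the oscillation of [m]. *)
Lemma laplacian_energy N (adj : nat -> nat -> bool) (m : nat -> R) c :
  (forall i j, adj i j = adj j i) ->
  rsum N (fun i => rsum N (fun j => if adj i j then (m i - m j) ^ 2 else 0)) =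
  2 * rsum N (fun i => (m i - c) * laplacian N adj m i).
Proof.
  intros Hsym.
  assert (E : forall i, (m i - c) * laplacian N adj m i =
              rsum N (fun j => if adj i j then (m i - c) * (m i - m j) else 0)).
  { intros i. unfold laplacian. rewrite <- rsum_scal. apply rsum_ext.
    intros j _. destruct (adj i j); ring. }
  set (T := rsum N (fun i =>
    rsum N (fun j => if adj i j then (m i - c) * (m i - m j) else 0))).
  replace (rsum N (fun i => (m i - c) * laplacian N adj m i)) with T
    by (symmetry; apply rsum_ext; auto).
  assert (Hs : T = rsum N (fun i =>
    rsum N (fun j => if adj j i then (m j - c) * (m j - m i) else 0))).
  { unfold T. apply rsum_swap. }
  replace (2 * T) with (T + T) by ring.
  rewrite Hs at 2. unfold T. rewrite <- rsum_plus.
  apply rsum_ext. intros i _. rewrite <- rsum_plus. apply rsum_ext.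
  intros j _. rewrite (Hsym j i). destruct (adj i j); ring.
Qed.

(** [K] is the length of a path and is fixed before [m] and [q], so it depends on the graph
    alone. *)
Lemma reach_oscillation N adj i :
  forall k, reach N adj i k -> exists K, forall (m : nat -> R) q, 0 <= q ->
    (forall j l, (j < N)%nat -> (l < N)%nat -> adj j l = true ->
       Rabs (m j - m l) <= q) ->
    Rabs (m k - m i) <= K * q.
Proof.
  induction 1 as [|j k _ [K IH] Hj Hk Hadj].
  - exists 0. intros m q Hq _. rewrite Rminus_diag, Rabs_R0. lra.
  - exists (K + 1). intros m q Hq H. specialize (IH m q Hq H).
    specialize (H j k Hj Hk Hadj). rewrite Rabs_minus_sym in H.
    pose proof (Rabs_triang (m k - m j) (m j - m i)) as Ht.
    replace (m k - m j + (m j - m i)) with (m k - m i) in Ht by ring. lra.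
Qed.

(** A Poincaré inequality without eigenvalues. The root [q] of the energy bounds every edge
    difference, hence [K * q] bounds the oscillation, and summation by parts gives
    [q * q <= 2 * N * K * C * q]. *)
Lemma laplacian_bounded N adj C :
  connected_undirected N adj -> 0 <= C ->
  exists B, 0 <= B /\ forall m : nat -> R,
    (forall i, (i < N)%nat -> Rabs (laplacian N adj m i) <= C) ->
    forall i, (i < N)%nat -> Rabs (m i - m O) <= B.
Proof.
  intros [Hsym Hconn] HC.
  destruct (finite_bound N (fun k K => forall (m : nat -> R) q, 0 <= q ->
    (forall j l, (j < N)%nat -> (l < N)%nat -> adj j l = true ->
       Rabs (m j - m l) <= q) ->
    Rabs (m k - m O) <= K * q)) as [K [HK0 HK]].
  { intros i B B' HB H m q Hq Hm. specialize (H m q Hq Hm). nra. }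
  { intros k Hk. apply reach_oscillation with (N := N) (adj := adj).
    apply Hconn; lia. }
  set (B := 2 * (INR N * (K * C))).
  assert (HB : 0 <= B).
  { pose proof (pos_INR N). unfold B. assert (0 <= K * C) by nra. nra. }
  exists (K * B). split; [nra|]. intros m Hm.
  set (En := rsum N (fun i =>
    rsum N (fun j => if adj i j then (m i - m j) ^ 2 else 0))).
  assert (Hpos : forall i j, 0 <= (if adj i j then (m i - m j) ^ 2 else 0)).
  { intros i j. destruct (adj i j); [apply pow2_ge_0|lra]. }
  assert (HEn : 0 <= En).
  { apply rsum_nonneg; intros; apply rsum_nonneg; auto. }
  set (q := sqrt En).
  assert (Hq : 0 <= q) by apply sqrt_pos.
  assert (Hqq : q * q = En) by (apply sqrt_sqrt; auto).
  assert (Hedge : forall j l, (j < N)%nat -> (l < N)%nat -> adj j l = true ->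
                    Rabs (m j - m l) <= q).
  { intros j l Hj Hl Ha.
    assert (Hle : (m j - m l) ^ 2 <= En).
    { eapply Rle_trans; [|apply (rsum_term_le N (fun i =>
        rsum N (fun j => if adj i j then (m i - m j) ^ 2 else 0)) j); auto].
      - pose proof (rsum_term_le N
          (fun l => if adj j l then (m j - m l) ^ 2 else 0) l) as Ht.
        cbv beta in Ht. rewrite Ha in Ht. apply Ht; auto.
      - intros; apply rsum_nonneg; auto. }
    rewrite <- sqrt_Rsqr_abs. apply sqrt_le_1_alt. unfold Rsqr. lra. }
  assert (Hosc : forall k, (k < N)%nat -> Rabs (m k - m O) <= K * q).
  { intros k Hk. apply HK; auto. }
  assert (HEB : En <= B * q).
  { unfold En. rewrite (laplacian_energy N adj m (m O)); auto.
    assert (Hs : rsum N (fun i => (m i - m O) * laplacian N adj m i) <=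
                 rsum N (fun _ => K * q * C)).
    { apply rsum_le. intros i Hi. eapply Rle_trans; [apply Rle_abs|].
      rewrite Rabs_mult. apply Rmult_le_compat; auto using Rabs_pos. }
    rewrite rsum_const in Hs. unfold B. nra. }
  assert (HqB : q <= B).
  { destruct (Rle_dec q B) as [|Hgt]; [auto|]. nra. }
  intros i Hi. specialize (Hosc i Hi). nra.
Qed.

(** * Nonintegral agents at a unique optimum *)

(* [B] selects the vectors; its indicator sum counts them. *)
Lemma linear_dependence (N : nat) (S : nat) :
  forall (B : nat -> bool) (V : nat -> nat -> R),
  INR S < rsum N (fun i => if B i then 1 else 0) ->
  exists lam : nat -> R,
    (forall i, B i = false -> lam i = 0) /\
    (exists i, (i < N)%nat /\ lam i <> 0) /\
    (forall s, (s < S)%nat -> rsum N (fun i => lam i * V i s) = 0).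
Proof.
  induction S as [|S IH]; intros B V H.
  - destruct (rsum_exists_pos N _ H) as [p [Hp HBp]].
    exists (fun i => if (i =? p)%nat then 1 else 0). split; [|split].
    + intros i Hi. destruct (Nat.eqb_spec i p) as [->|]; auto.
      rewrite Hi in HBp. lra.
    + exists p. rewrite Nat.eqb_refl. split; [auto|lra].
    + intros; lia.
  - rewrite S_INR in H.
    destruct (classic (exists p, (p < N)%nat /\ B p = true /\ V p S <> 0))
      as [[p [Hp [HBp HV]]]|Hno].
    (* Gaussian elimination with pivot [p]: the last coordinate is cleared from all vectors and [p]
       leaves the selection. *)
    + destruct (IH (fun i => if (i =? p)%nat then false else B i)
        (fun i s => V i s - V i S / V p S * V p s)) as [lam [H1 [[i0 [Hi0 Hl0]] H3]]].
      { rewrite rsum_ext with (g := fun i => (if B i then 1 else 0) -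
          (if (i =? p)%nat then (fun _ => 1) i else 0)).
        - rewrite rsum_minus, rsum_single; auto. lra.
        - intros i _. destruct (Nat.eqb_spec i p) as [->|];
            [rewrite HBp|destruct (B i)]; lra. }
      assert (Hlp : lam p = 0) by (apply H1; rewrite Nat.eqb_refl; auto).
      (* The coefficient of the pivot that collects the multiples of [V p] subtracted by the
         elimination. *)
      set (c := - rsum N (fun i => lam i * (V i S / V p S))).
      exists (fun i => lam i + if (i =? p)%nat then c else 0).
      assert (Hsum : forall s,
        rsum N (fun i => (lam i + if (i =? p)%nat then c else 0) * V i s) =
        rsum N (fun i => lam i * (V i s - V i S / V p S * V p s))).
      { intros s.
        rewrite rsum_ext with (g := fun i => lam i * V i s +
           (if (i =? p)%nat then (fun i => c * V i s) i else 0)).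
        2: { intros i _. destruct (i =? p)%nat; ring. }
        rewrite rsum_plus, rsum_single by auto. unfold c.
        rewrite (rsum_ext N (fun i => lam i * (V i s - V i S / V p S * V p s))
          (fun i => lam i * V i s - V p s * (lam i * (V i S / V p S))))
          by (intros; ring).
        rewrite rsum_minus, rsum_scal. ring. }
      split; [|split].
      * intros i Hi. destruct (Nat.eqb_spec i p) as [->|Hne]; [congruence|].
        rewrite H1; [lra|]. destruct (Nat.eqb_spec i p); auto.
      * exists i0. split; auto. destruct (Nat.eqb_spec i0 p); [congruence|lra].
      * intros s Hs. rewrite Hsum. destruct (Nat.eq_dec s S) as [->|].
        -- apply rsum_zero. intros i Hi. field; auto.
        -- apply H3; lia.
    + destruct (IH B V) as [lam [H1 [H2 H3]]]; [lra|].
      exists lam. split; [auto|split; [auto|]]. intros s Hs.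
      destruct (Nat.eq_dec s S) as [->|]; [|apply H3; lia].
      apply rsum_zero. intros i Hi.
      destruct (B i) eqn:HBi; [|rewrite H1; auto; lra].
      destruct (Req_dec (V i S) 0) as [->|]; [lra|].
      exfalso. apply Hno. eauto.
Qed.

Lemma Ax_line P i s x d t :
  Ax P i s (fun k => x k + t * d k) = Ax P i s x + t * Ax P i s d.
Proof.
  unfold Ax. rewrite <- rsum_scal, <- rsum_plus. apply rsum_ext; intros; ring.
Qed.

Lemma cx_line P i x d t :
  cx P i (fun k => x k + t * d k) = cx P i x + t * cx P i d.
Proof.
  unfold cx. rewrite <- rsum_scal, <- rsum_plus. apply rsum_ext; intros; ring.
Qed.

(* Shifting weight to or from a generator with positive weight. *)
Lemma nonextreme_direction P i z :
  inconv P i z -> ~ inX P i z ->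
  exists d, (exists k, (k < dim P i)%nat /\ d k <> 0) /\
    forall t, -1 <= t <= 1 -> inconv P i (fun k => z k + t * d k).
Proof.
  intros Hz HnX. assert (Hz0 := inconv_dim P i z Hz).
  destruct Hz as [p [w [xs [H1 [H2 H3]]]]].
  destruct (rsum_exists_pos p w) as [j [Hj Hwj]]; [lra|].
  assert (Hne : exists k, (k < dim P i)%nat /\ xs j k - z k <> 0).
  { apply NNPP. intros Hno. apply HnX. replace z with (xs j); [apply H1; auto|].
    apply functional_extensionality. intros k.
    destruct (Nat.lt_ge_cases k (dim P i)) as [Hk|Hk].
    - destruct (Req_dec (xs j k - z k) 0); [lra|]. exfalso; eauto.
    - rewrite Hz0 by auto. apply H1; auto. }
  assert (Hw1 : w j <= 1).
  { rewrite <- H2. apply rsum_term_le; auto. intros; apply H1; auto. }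
  (* With the factor [w j], the new weight of generator [j] is [w j * (1 + t * (1 - w j))], which is
     nonnegative down to [t = -1]. *)
  exists (fun k => w j * (xs j k - z k)). split.
  - destruct Hne as [k [Hk Hd]]. exists k. split; auto.
    apply Rmult_integral_contrapositive_currified; lra.
  - intros t Ht.
    exists p, (fun l => (1 - t * w j) * w l + if (l =? j)%nat then t * w j else 0), xs.
    split; [|split].
    + intros l Hl. destruct (H1 l Hl) as [Hwl Hx]. split; auto.
      destruct (Nat.eqb_spec l j) as [->|].
      * assert (0 <= w j * (1 - w j)) by nra. assert (0 <= w j * (1 + t)) by nra. nra.
      * rewrite Rplus_0_r. apply Rmult_le_pos; nra.
    + rewrite rsum_plus, rsum_scal, H2.
      rewrite (rsum_single p j (fun _ => t * w j)) by auto. ring.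
    + intros k.
      rewrite rsum_ext with (g := fun l => (1 - t * w j) * (w l * xs l k) +
        (if (l =? j)%nat then (fun l => t * w j * xs l k) l else 0)).
      * rewrite rsum_plus, rsum_scal, rsum_single, <- H3 by auto. ring.
      * intros l _. destruct (l =? j)%nat; ring.
Qed.

Lemma few_nonintegral P r z (B : nat -> bool) :
  lpr_optimal P r z ->
  (forall z', lpr_optimal P r z' ->
     forall i k, (i < nag P)%nat -> z' i k = z i k) ->
  (forall i, (i < nag P)%nat -> B i = true -> ~ inX P i (z i)) ->
  rsum (nag P) (fun i => if B i then 1 else 0) <= INR (ncon P).
Proof.
  intros [[Hz1 Hz2] Hopt] Huniq HB.
  apply Rnot_lt_le. intros Hcount. set (N := nag P) in *.
  assert (Hdir : forall i, exists d, (i < N)%nat -> B i = true ->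
    (exists k, (k < dim P i)%nat /\ d k <> 0) /\
    forall t, -1 <= t <= 1 -> inconv P i (fun k => z i k + t * d k)).
  { intros i. destruct (classic ((i < N)%nat /\ B i = true)) as [[Hi HBi]|Hn].
    - destruct (nonextreme_direction P i (z i)) as [d Hd]; auto.
      exists d. auto.
    - exists (fun _ => 0). intros Hi HBi. tauto. }
  set (d := fun i => proj1_sig (constructive_indefinite_description _ (Hdir i))).
  assert (Hd : forall i, (i < N)%nat -> B i = true ->
    (exists k, (k < dim P i)%nat /\ d i k <> 0) /\
    forall t, -1 <= t <= 1 -> inconv P i (fun k => z i k + t * d i k)).
  { intros i. exact (proj2_sig (constructive_indefinite_description _ (Hdir i))). }
  clearbody d. clear Hdir.
  destruct (linear_dependence N (ncon P) B (fun i s => Ax P i s (d i)) Hcount)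
    as [lam [Hl1 [[i0 [Hi0 Hl0]] Hl3]]].
  (* Dividing [lam] by [Sg] keeps the step of every agent within [-1, 1]; the leading 1 makes [Sg]
     positive. *)
  set (Sg := 1 + rsum N (fun i => Rabs (lam i))).
  assert (HSg : 1 <= Sg).
  { assert (0 <= rsum N (fun i => Rabs (lam i)))
      by (apply rsum_nonneg; intros; apply Rabs_pos). unfold Sg; lra. }
  assert (Hlam : forall i, (i < N)%nat -> Rabs (lam i) <= Sg).
  { intros i Hi. pose proof (rsum_term_le N (fun i => Rabs (lam i)) i) as Ht.
    cbv beta in Ht. unfold Sg. specialize (Ht (fun _ _ => Rabs_pos _) Hi). lra. }
  set (zt := fun t i k => z i k + t * (lam i / Sg) * d i k).
  assert (Hfeas : forall t, -1 <= t <= 1 -> lpr_feasible P r (zt t)).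
  { intros t Ht. split.
    - intros i Hi. unfold zt. destruct (B i) eqn:HBi.
      + apply (Hd i Hi HBi).
        assert (-1 <= lam i / Sg <= 1).
        { specialize (Hlam i Hi).
          pose proof (Rle_abs (lam i)). pose proof (Rle_abs (- lam i)).
          rewrite Rabs_Ropp in *.
          assert (E : lam i = lam i / Sg * Sg) by (field; lra).
          split; apply Rmult_le_reg_r with Sg; lra. }
        split; nra.
      + rewrite Hl1 by auto.
        replace (fun k => z i k + t * (0 / Sg) * d i k) with (z i); [auto|].
        apply functional_extensionality. intros k. field. lra.
    - intros s Hs. fold N.
      rewrite rsum_ext with
        (g := fun i => Ax P i s (z i) + t / Sg * (lam i * Ax P i s (d i))).
      + rewrite rsum_plus, rsum_scal, Hl3 by auto.
        specialize (Hz2 s Hs). fold N in Hz2. lra.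
      + intros i _. unfold zt. rewrite Ax_line. field. lra. }
  set (Dl := rsum N (fun i => lam i / Sg * cx P i (d i))).
  assert (Hobj : forall t, lpr_obj P (zt t) = lpr_obj P z + t * Dl).
  { intros t. unfold lpr_obj, Dl. fold N.
    rewrite <- rsum_scal, <- rsum_plus. apply rsum_ext. intros i _.
    unfold zt. rewrite cx_line. ring. }
  (* The objective is affine in [t] and feasible steps of both signs cannot improve it. So [zt 1] is
     a second optimum. *)
  assert (HDl : Dl = 0).
  { assert (A1 := Hopt _ (Hfeas 1 ltac:(lra))).
    assert (A2 := Hopt _ (Hfeas (-1) ltac:(lra))).
    rewrite Hobj in A1, A2. lra. }
  assert (Hopt1 : lpr_optimal P r (zt 1)).
  { split; [apply Hfeas; lra|]. rewrite Hobj, HDl.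
    intros z' Hz'. specialize (Hopt z' Hz'). lra. }
  destruct (B i0) eqn:HBi; [|apply Hl0; auto].
  destruct (Hd i0 Hi0 HBi) as [[k [_ Hdk]] _].
  pose proof (Huniq _ Hopt1 i0 k Hi0) as He. unfold zt in He.
  assert (Hprod : lam i0 * d i0 k = 0).
  { apply Rmult_eq_reg_l with (/ Sg); [|apply Rinv_neq_0_compat; lra].
    unfold Rdiv in He. lra. }
  apply Rmult_integral in Hprod. tauto.
Qed.

(** * Optimality of the limit allocation *)

Lemma eventually_all (n : nat) (Q : nat -> nat -> Prop) :
  (forall i, (i < n)%nat -> exists T, forall t, (T <= t)%nat -> Q i t) ->
  exists T, forall t, (T <= t)%nat -> forall i, (i < n)%nat -> Q i t.
Proof.
  induction n as [|n IH]; intros H.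
  - exists 0%nat. intros; lia.
  - destruct IH as [T HT]; [auto|]. destruct (H n) as [T' HT']; [lia|].
    exists (T + T')%nat. intros t Ht i Hi.
    destruct (Nat.eq_dec i n) as [->|]; [apply HT'; lia|apply HT; lia].
Qed.

Lemma eventually_close (N S : nat) (y : nat -> nat -> nat -> R) yinf eps :
  (forall i s, (i < N)%nat -> (s < S)%nat -> Un_cv (fun t => y t i s) (yinf i s)) ->
  0 < eps ->
  exists T, forall t, (T <= t)%nat -> forall i, (i < N)%nat ->
    forall s, (s < S)%nat -> Rabs (y t i s - yinf i s) <= eps.
Proof.
  intros Hcv Heps. apply eventually_all. intros i Hi.
  apply eventually_all. intros s Hs.
  destruct (Hcv i s Hi Hs eps Heps) as [T HT]. exists T. intros t Ht.
  apply Rlt_le, HT; auto.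
Qed.

Lemma rsum_cv n (f : nat -> nat -> R) l :
  (forall i, (i < n)%nat -> Un_cv (fun t => f t i) (l i)) ->
  Un_cv (fun t => rsum n (f t)) (rsum n l).
Proof.
  induction n as [|n IH]; simpl; intros H.
  - intros eps Heps. exists 0%nat. intros. rewrite Rdist_eq; auto.
  - apply (CV_plus (fun t => rsum n (f t)) (fun t => f t n)); auto.
Qed.

(** The approximating [z] may vary arbitrarily with [eps]: only the perturbed bounds have to
    converge, in the projected space. *)
Lemma allocation_closed P (y : nat -> nat -> R) (c : R) :
  local_sets_ok P ->
  (forall eps, 0 < eps -> exists z,
     (forall i, (i < nag P)%nat -> inconv P i (z i)) /\
     (forall i s, (i < nag P)%nat -> (s < ncon P)%nat ->
        Ax P i s (z i) <= y i s + eps) /\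
     lpr_obj P z <= c + eps) ->
  exists z,
     (forall i, (i < nag P)%nat -> inconv P i (z i)) /\
     (forall i s, (i < nag P)%nat -> (s < ncon P)%nat -> Ax P i s (z i) <= y i s) /\
     lpr_obj P z <= c.
Proof.
  intros Hok Happ. set (N := nag P) in *. set (m := ncon P) in *.
  (* Row [i * m + s] is constraint [s] of agent [i] alone, and row [N * m] is the total cost. *)
  set (F := fun j i k => if (j <? N * m)%nat
    then (if (i =? j / m)%nat then Acoup P i (j mod m) k else 0) else cost P i k).
  set (x := fun (y : nat -> nat -> R) (c : R) (j : nat) =>
    if (j <? N * m)%nat then y (j / m)%nat (j mod m)%nat else c).
  assert (HFobj : forall z,
    rsum N (fun i => rsum (dim P i) (fun k => F (N * m)%nat i k * z i k)) = lpr_obj P z).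
  { intros z. unfold F. rewrite Nat.ltb_irrefl. reflexivity. }
  assert (HFA : forall z j, (j < N * m)%nat -> (j / m < N)%nat ->
    rsum N (fun i => rsum (dim P i) (fun k => F j i k * z i k)) =
    Ax P (j / m) (j mod m) (z (j / m)%nat)).
  { intros z j Hj Hjm. unfold F. destruct (Nat.ltb_spec j (N * m)); [|lia].
    rewrite rsum_ext with (g := fun i => if (i =? j / m)%nat
      then (fun i => Ax P i (j mod m) (z i)) i else 0).
    - rewrite rsum_single; auto.
    - intros i _. destruct (i =? j / m)%nat; [reflexivity|].
      apply rsum_zero; intros; ring. }
  assert (Hmem : forall y c,
    (exists z, (forall i, (i < N)%nat -> inconv P i (z i)) /\
      (forall j, (j < S (N * m))%nat ->
        rsum N (fun i => rsum (dim P i) (fun k => F j i k * z i k)) <= x y c j)) <->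
    (exists z, (forall i, (i < N)%nat -> inconv P i (z i)) /\
      (forall i s, (i < N)%nat -> (s < m)%nat -> Ax P i s (z i) <= y i s) /\
      lpr_obj P z <= c)).
  { intros y' c'. split; intros [z [H1 H2]]; exists z; (split; [auto|]).
    - split.
      + intros i s Hi Hs.
        assert (E1 : ((i * m + s) / m = i)%nat).
        { rewrite Nat.div_add_l, Nat.div_small by lia. lia. }
        assert (E2 : ((i * m + s) mod m = s)%nat).
        { rewrite Nat.add_comm, Nat.Div0.mod_add, Nat.mod_small by lia. auto. }
        assert (Hj : (i * m + s < N * m)%nat) by nia.
        specialize (H2 (i * m + s)%nat). rewrite HFA in H2; [|auto|lia].
        unfold x in H2. destruct (Nat.ltb_spec (i * m + s) (N * m)); [|lia].
        rewrite E1, E2 in H2. apply H2; lia.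
      + rewrite <- HFobj. specialize (H2 (N * m)%nat). unfold x in H2.
        rewrite Nat.ltb_irrefl in H2. apply H2; lia.
    - destruct H2 as [H2 H3]. intros j Hj.
      destruct (Nat.ltb_spec j (N * m)) as [Hlt|Hge].
      + assert (m <> 0)%nat by (intros E; rewrite E in *; lia).
        assert (Hjm : (j / m < N)%nat) by (apply Nat.Div0.div_lt_upper_bound; lia).
        rewrite HFA; auto. unfold x. destruct (Nat.ltb_spec j (N * m)); [|lia].
        apply H2; auto. apply Nat.mod_upper_bound; auto.
      + assert (j = (N * m)%nat) as -> by lia. rewrite HFobj.
        unfold x. rewrite Nat.ltb_irrefl. auto. }
  apply Hmem.
  apply (polyhedron_closed _ _ (x y c) (joint_projection_polyhedron P (S (N * m)) F Hok)).
  intros eps Heps. exists (x (fun i s => y i s + eps) (c + eps)). split.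
  - apply Hmem. auto.
  - intros j _. unfold x.
    destruct (j <? N * m)%nat;
      match goal with |- Rabs (?a + eps - ?a) <= eps =>
        replace (a + eps - a) with eps by ring end;
      rewrite Rabs_pos_eq; lra.
Qed.

(** The Lagrangian has slope [M] minus the sum of the multipliers in [v]; a negative slope would
    make [v + 1] better. *)
Lemma multiplier_bound P M i y z v mu s :
  p1_pd_optimal P M i y z v mu -> (s < ncon P)%nat -> 0 <= mu s <= M.
Proof.
  intros [[Hz [Hv _]] [_ [Hmu [Hlag _]]]] Hs. split; [auto|].
  specialize (Hlag z (v + 1) Hz ltac:(lra)). unfold lag1 in Hlag.
  rewrite (rsum_ext _ (fun s => mu s * (Ax P i s z - y s - (v + 1)))
    (fun s => mu s * (Ax P i s z - y s - v) - mu s)) in Hlag by (intros; ring).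
  rewrite rsum_minus in Hlag.
  pose proof (rsum_term_le (ncon P) mu s Hmu Hs). lra.
Qed.

(** This is the subgradient inequality towards the allocation A_i z', at which [z'] incurs no
    penalty. *)
Lemma value_subgradient P M i y z v mu z' :
  p1_pd_optimal P M i y z v mu -> inconv P i z' ->
  cx P i z + M * v <=
  cx P i z' + rsum (ncon P) (fun s => mu s * (Ax P i s z' - y s)).
Proof.
  intros [_ [_ [_ [Hlag Hcs]]]] Hz'.
  specialize (Hlag z' 0 Hz' ltac:(lra)). unfold lag1 in Hlag. rewrite Hcs in Hlag.
  rewrite (rsum_ext _ (fun s => mu s * (Ax P i s z' - y s - 0))
    (fun s => mu s * (Ax P i s z' - y s))) in Hlag by (intros; ring).
  lra.
Qed.

(* If the objective stayed above [opt + eps], the step-weighted sum of the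
   subgradient inequalities at [zs] would diverge; but convergence of [y] bounds
   the Laplacian of the accumulated multipliers, so these agree across agents up
   to a constant, and a common multiplier contributes nonpositively because
   [zs] is feasible. *)
Lemma near_optimal P M adj alpha y z v mu yinf r zs :
  connected_undirected (nag P) adj -> assumptionB alpha ->
  0 < M ->
  (forall t i, (i < nag P)%nat ->
     p1_pd_optimal P M i (y t i) (z t i) (v t i) (mu t i)) ->
  (forall t i s, (i < nag P)%nat -> (s < ncon P)%nat ->
     y (S t) i s =
     y t i s + alpha t * laplacian (nag P) adj (fun j => mu t j s) i) ->
  (forall i s, (i < nag P)%nat -> (s < ncon P)%nat ->
     Un_cv (fun t => y t i s) (yinf i s)) ->
  (forall s, (s < ncon P)%nat ->
     rsum (nag P) (fun i => yinf i s) = bcoup P s - r s) ->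
  lpr_feasible P r zs ->
  forall eps t0, 0 < eps ->
  exists t, (t0 <= t)%nat /\
    rsum (nag P) (fun i => cx P i (z t i) + M * v t i) < lpr_obj P zs + eps.
Proof.
  intros Hconn [Ha [Hdiv _]] HM Hpd Hupd Hcv Hsum [Hzs1 Hzs2] eps t0 Heps.
  apply NNPP. intros Hno.
  assert (Hlow : forall t, (t0 <= t)%nat -> lpr_obj P zs + eps <=
            rsum (nag P) (fun i => cx P i (z t i) + M * v t i)).
  { intros t Ht. apply Rnot_lt_le. intros Hlt. apply Hno. eauto. }
  clear Hno. set (N := nag P) in *. set (K := ncon P) in *.
  (* All multipliers lie in [0, M], so replacing [y t] by [yinf] within [delta] costs at most
     [W * delta], half of [eps]. *)
  set (W := INR N * (INR K * M)).
  assert (HW : 0 <= W).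
  { pose proof (pos_INR N). pose proof (pos_INR K).
    assert (0 <= INR K * M) by nra. unfold W. nra. }
  set (delta := eps / 2 / (W + 1)).
  assert (Hdelta : 0 < delta) by (apply Rdiv_lt_0_compat; lra).
  assert (HWd : W * delta <= eps / 2).
  { assert (E : delta * (W + 1) = eps / 2) by (unfold delta; field; lra). nra. }
  destruct (eventually_close N K y yinf delta Hcv Hdelta) as [t1' Ht1'].
  set (t1 := (t0 + t1')%nat).
  assert (Hclose : forall t i s, (t1 <= t)%nat -> (i < N)%nat -> (s < K)%nat ->
            Rabs (y t i s - yinf i s) <= delta).
  { intros t i s Ht Hi Hs. apply Ht1'; auto; unfold t1 in Ht; lia. }
  (* The excess of [zs] over the limit allocation; single agents may exceed it, but the total over
     agents is nonpositive. *)
  set (e := fun i s => Ax P i s (zs i) - yinf i s).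
  assert (He : forall s, (s < K)%nat -> rsum N (fun i => e i s) <= 0).
  { intros s Hs. unfold e. rewrite rsum_minus, Hsum by auto.
    specialize (Hzs2 s Hs). fold N in Hzs2. lra. }
  assert (Hgain : forall t, (t1 <= t)%nat ->
            eps / 2 <= rsum N (fun i => rsum K (fun s => mu t i s * e i s))).
  { intros t Ht.
    assert (A1 : rsum N (fun i => cx P i (z t i) + M * v t i) <=
      rsum N (fun i => cx P i (zs i) +
        (rsum K (fun s => mu t i s * e i s) + INR K * (M * delta)))).
    { apply rsum_le. intros i Hi.
      eapply Rle_trans; [apply (value_subgradient P M i _ _ _ _ (zs i) (Hpd t i Hi));
        apply Hzs1; auto|].
      apply Rplus_le_compat_l. rewrite <- rsum_const, <- rsum_plus.
      apply rsum_le. intros s Hs.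
      destruct (multiplier_bound P M i _ _ _ _ s (Hpd t i Hi) Hs) as [Hm1 Hm2].
      specialize (Hclose t i s Ht Hi Hs).
      pose proof (Rle_abs (- (y t i s - yinf i s))) as Habs.
      rewrite Rabs_Ropp in Habs. unfold e.
      assert (mu t i s * (yinf i s - y t i s) <= M * delta).
      { apply Rle_trans with (mu t i s * delta); [|nra].
        apply Rmult_le_compat_l; lra. }
      lra. }
    assert (Ht0 : (t0 <= t)%nat) by (unfold t1 in Ht; lia).
    specialize (Hlow t Ht0).
    apply (Rle_trans _ _ _ Hlow) in A1.
    rewrite rsum_plus, rsum_plus, rsum_const in A1.
    change (rsum N (fun i => cx P i (zs i))) with (lpr_obj P zs) in A1.
    replace (INR N * (INR K * (M * delta))) with (W * delta) in A1
      by (unfold W; ring).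
    lra. }
  set (beta := fun t => alpha (t1 + t)%nat).
  set (acc := fun T s i => rsum T (fun t => beta t * mu (t1 + t)%nat i s)).
  assert (Hacc : forall T s i, (i < N)%nat -> (s < K)%nat ->
    y (t1 + T)%nat i s = y t1 i s + laplacian N adj (acc T s) i).
  { induction T as [|T IH]; intros s i Hi Hs.
    - rewrite Nat.add_0_r. unfold laplacian. rewrite rsum_zero; [lra|].
      intros j _. unfold acc; simpl. destruct (adj i j); lra.
    - rewrite Nat.add_succ_r, Hupd, IH by auto.
      rewrite Rplus_assoc. f_equal. unfold laplacian.
      rewrite <- rsum_scal, <- rsum_plus. apply rsum_ext. intros j _.
      unfold acc; simpl. unfold beta. destruct (adj i j); ring. }
  (* Both [y t1] and [y (t1 + T)] are within [delta] of the limit. *)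
  destruct (laplacian_bounded N adj (2 * delta) Hconn) as [B [HB0 HB]]; [lra|].
  assert (Hosc : forall T s i, (s < K)%nat -> (i < N)%nat ->
            Rabs (acc T s i - acc T s O) <= B).
  { intros T s i Hs Hi. apply HB; auto. intros i' Hi'.
    replace (laplacian N adj (acc T s) i') with
      ((y (t1 + T)%nat i' s - yinf i' s) + - (y t1 i' s - yinf i' s))
      by (rewrite Hacc by auto; ring).
    eapply Rle_trans; [apply Rabs_triang|]. rewrite Rabs_Ropp.
    assert (A1 := Hclose (t1 + T)%nat i' s ltac:(lia) Hi' Hs).
    assert (A2 := Hclose t1 i' s ltac:(lia) Hi' Hs). lra. }
  set (R0 := rsum K (fun s => rsum N (fun i => Rabs (e i s) * B))).
  assert (Hbound : forall T, rsum T beta * (eps / 2) <= R0).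
  { intros T.
    apply Rle_trans with (rsum T (fun t => beta t *
      rsum N (fun i => rsum K (fun s => mu (t1 + t)%nat i s * e i s)))).
    { rewrite Rmult_comm, <- rsum_scal. apply rsum_le. intros t _.
      assert (0 <= beta t) by apply Ha.
      specialize (Hgain (t1 + t)%nat ltac:(lia)). nra. }
    replace (rsum T (fun t => beta t *
      rsum N (fun i => rsum K (fun s => mu (t1 + t)%nat i s * e i s))))
      with (rsum K (fun s => rsum N (fun i => e i s * acc T s i))).
    2: { symmetry. rewrite (rsum_swap K N). unfold acc.
      rewrite (rsum_ext T _ (fun t => rsum N (fun i => rsum K (fun s =>
        beta t * (mu (t1 + t)%nat i s * e i s))))).
      2: { intros t _. rewrite <- rsum_scal. apply rsum_ext. intros i _.
           rewrite <- rsum_scal. reflexivity. }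
      rewrite (rsum_swap T N). apply rsum_ext. intros i _.
      rewrite (rsum_swap T K). apply rsum_ext. intros s _.
      rewrite <- rsum_scal. apply rsum_ext. intros t _. ring. }
    unfold R0. apply rsum_le. intros s Hs.
    (* Agent [O] supplies the common multiplier; the deviations from it are bounded uniformly in
       [T]. *)
    rewrite (rsum_ext N (fun i => e i s * acc T s i)
      (fun i => e i s * (acc T s i - acc T s O) + acc T s O * e i s))
      by (intros; ring).
    rewrite rsum_plus, rsum_scal.
    assert (A1 : acc T s O * rsum N (fun i => e i s) <= 0).
    { destruct (Nat.eq_dec N 0) as [->|HN]; [simpl; lra|].
      assert (0 <= acc T s O).
      { unfold acc. apply rsum_nonneg. intros t _. apply Rmult_le_pos; [apply Ha|].
        apply (multiplier_bound P M O _ _ _ _ s (Hpd (t1 + t)%nat O ltac:(lia)) Hs). }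
      specialize (He s Hs). nra. }
    assert (A2 : rsum N (fun i => e i s * (acc T s i - acc T s O)) <=
                 rsum N (fun i => Rabs (e i s) * B)).
    { apply rsum_le. intros i Hi. eapply Rle_trans; [apply Rle_abs|].
      rewrite Rabs_mult. apply Rmult_le_compat_l; [apply Rabs_pos|auto]. }
    lra. }
  (* The bound concerns only the steps from [t1] on, so the earlier ones are added to the
     threshold. *)
  destruct (Hdiv (rsum t1 alpha + R0 / (eps / 2))) as [T HT].
  specialize (Hbound T).
  assert (Hge : rsum T alpha <= rsum (t1 + T) alpha).
  { rewrite Nat.add_comm, rsum_app.
    assert (0 <= rsum t1 (fun j => alpha (T + j)%nat))
      by (apply rsum_nonneg; intros; apply Ha). lra. }
  rewrite rsum_app in Hge. change (rsum T (fun j => alpha (t1 + j)%nat)) with (rsum T beta) in Hge.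
  assert (HR : R0 / (eps / 2) < rsum T beta) by lra.
  apply Rmult_lt_compat_r with (r := eps / 2) in HR; [|lra].
  replace (R0 / (eps / 2) * (eps / 2)) with R0 in HR by (field; lra).
  lra.
Qed.

Lemma limit_allocation_optimal P r zs :
  local_sets_ok P -> lpr_optimal P r zs ->
  exists M0 : R, forall M : R, 0 < M -> M0 < M ->
  forall adj alpha, connected_undirected (nag P) adj -> assumptionB alpha ->
  forall y z v mu yinf,
  (forall s, (s < ncon P)%nat ->
     rsum (nag P) (fun i => y O i s) = bcoup P s - r s) ->
  (forall t i, (i < nag P)%nat ->
     p1_pd_optimal P M i (y t i) (z t i) (v t i) (mu t i)) ->
  (forall t i s, (i < nag P)%nat -> (s < ncon P)%nat ->
     y (S t) i s =
     y t i s + alpha t * laplacian (nag P) adj (fun j => mu t j s) i) ->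
  (forall i s, (i < nag P)%nat -> (s < ncon P)%nat ->
     Un_cv (fun t => y t i s) (yinf i s)) ->
  (forall s, (s < ncon P)%nat ->
     rsum (nag P) (fun i => yinf i s) = bcoup P s - r s) /\
  exists zinf, lpr_optimal P r zinf /\
    forall i s, (i < nag P)%nat -> (s < ncon P)%nat ->
      Ax P i s (zinf i) <= yinf i s.
Proof.
  intros Hok Hzs. destruct (exact_penalty P r zs Hok Hzs) as [M0 [_ Hpen]].
  exists M0. intros M HM HMM0 adj alpha Hconn HB y z v mu yinf Hinit Hpd Hupd Hcv.
  assert (Hcons : forall t s, (s < ncon P)%nat ->
            rsum (nag P) (fun i => y t i s) = bcoup P s - r s).
  { induction t as [|t IH]; intros s Hs; [auto|].
    rewrite (rsum_ext _ _ (fun i => y t i s +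
      alpha t * laplacian (nag P) adj (fun j => mu t j s) i)) by auto.
    rewrite rsum_plus, rsum_scal, laplacian_sum_zero, IH by (auto; apply Hconn).
    ring. }
  assert (Hinf : forall s, (s < ncon P)%nat ->
            rsum (nag P) (fun i => yinf i s) = bcoup P s - r s).
  { intros s Hs. apply UL_sequence with (fun t => rsum (nag P) (fun i => y t i s)).
    - apply (rsum_cv _ (fun t i => y t i s)). auto.
    - intros eps Heps. exists O. intros t _. rewrite Hcons, Rdist_eq; auto. }
  split; [exact Hinf|].
  destruct (allocation_closed P yinf (lpr_obj P zs) Hok) as [zinf [H1 [H2 H3]]].
  - intros eps Heps.
    destruct (eventually_close (nag P) (ncon P) y yinf (eps / 2) Hcv) as [t0 Ht0];
      [lra|].
    (* The second bound forces the total violation [w] below [eps / 2] through the margin [M - M0];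
       the other half of [eps] pays for the distance from [y t] to its limit. *)
    set (eta := Rmin eps ((M - M0) * (eps / 2))).
    assert (Heta : 0 < eta) by (apply Rmin_pos; nra).
    assert (Heta1 : eta <= eps) by apply Rmin_l.
    assert (Heta2 : eta <= (M - M0) * (eps / 2)) by apply Rmin_r.
    destruct (near_optimal P M adj alpha y z v mu yinf r zs Hconn HB HM Hpd Hupd Hcv
      Hinf (proj1 Hzs) eta t0 Heta) as [t [Ht Hval]].
    rewrite rsum_plus, rsum_scal in Hval.
    change (rsum (nag P) (fun i => cx P i (z t i))) with (lpr_obj P (z t)) in Hval.
    set (w := rsum (nag P) (v t)). change (rsum (nag P) (v t)) with w in Hval.
    assert (Hv : forall i, (i < nag P)%nat -> 0 <= v t i).
    { intros i Hi. apply (Hpd t i Hi). }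
    assert (Hw : 0 <= w) by (apply rsum_nonneg; auto).
    assert (Hconv : forall i, (i < nag P)%nat -> inconv P i (z t i)).
    { intros i Hi. apply (Hpd t i Hi). }
    assert (HAz : forall i s, (i < nag P)%nat -> (s < ncon P)%nat ->
              Ax P i s (z t i) <= y t i s + v t i).
    { intros i s Hi Hs. destruct (Hpd t i Hi) as [[_ [_ H]] _]. auto. }
    assert (Hp : lpr_obj P zs <= lpr_obj P (z t) + M0 * w).
    { apply Hpen; auto. intros s Hs. rewrite <- (Hcons t s Hs). unfold w.
      rewrite <- rsum_plus. apply rsum_le. auto. }
    assert (Hws : w <= eps / 2).
    { apply Rmult_le_reg_l with (M - M0); lra. }
    exists (z t). split; [auto|split].
    + intros i s Hi Hs. specialize (HAz i s Hi Hs).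
      pose proof (rsum_term_le (nag P) (v t) i Hv Hi) as Hvi. fold w in Hvi.
      specialize (Ht0 t Ht i Hi s Hs).
      pose proof (Rle_abs (y t i s - yinf i s)). lra.
    + nra.
  - exists zinf. split; [|auto]. split.
    + split; [auto|]. intros s Hs. rewrite <- Hinf by auto. apply rsum_le. auto.
    + intros z' Hz'. apply Rle_trans with (lpr_obj P zs); auto. apply Hzs; auto.
Qed.

(** * Violations at the limit allocation *)

Lemma inconv_Ax_lower P i s z l :
  (forall x, inX P i x -> l <= Ax P i s x) -> inconv P i z -> l <= Ax P i s z.
Proof.
  intros Hl [p [w [xs [H1 [H2 H3]]]]].
  replace (Ax P i s z) with (rsum p (fun j => w j * Ax P i s (xs j))).
  - replace l with (rsum p (fun j => l * w j)) by (rewrite rsum_scal, H2; ring).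
    apply rsum_le. intros j Hj. destruct (H1 j Hj) as [Hw Hx].
    specialize (Hl _ Hx). nra.
  - unfold Ax.
    rewrite (rsum_ext (dim P i) (fun k => Acoup P i s k * z k)
      (fun k => rsum p (fun j => w j * (Acoup P i s k * xs j k)))).
    + rewrite rsum_swap. apply rsum_ext. intros j _. rewrite rsum_scal. auto.
    + intros k _. rewrite H3, <- rsum_scal. apply rsum_ext; intros; ring.
Qed.

Theorem theorem1 :
  forall (P : milp_data),
  (exists x0, milp_feasible P x0) ->
  local_sets_ok P ->
  forall (L xL : nat -> nat -> R) (lt : nat -> R) (sigma : R),
  is_L P L -> is_xL P L xL lt -> is_sigmaASY P L xL sigma ->
  assumptionA P (fun _ => sigma) ->
  exists M0 : R, forall M : R, 0 < M -> M0 < M ->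
  forall (adj : nat -> nat -> bool), connected_undirected (nag P) adj ->
  forall (alpha : nat -> R), assumptionB alpha ->
  forall (y : nat -> nat -> nat -> R) (z : nat -> nat -> nat -> R)
         (v : nat -> nat -> R) (mu : nat -> nat -> nat -> R),
  (forall s, (s < ncon P)%nat ->
     rsum (nag P) (fun i => y O i s) = bcoup P s - sigma) ->
  (forall t i, (i < nag P)%nat ->
     p1_pd_optimal P M i (y t i) (z t i) (v t i) (mu t i)) ->
  (forall t i s, (i < nag P)%nat -> (s < ncon P)%nat ->
     y (S t) i s = y t i s + alpha t *
       rsum (nag P) (fun j => if adj i j then mu t i s - mu t j s else 0)) ->
  forall (yinf : nat -> nat -> R),
  (forall i s, (i < nag P)%nat -> (s < ncon P)%nat ->
     Un_cv (fun t => y t i s) (yinf i s)) ->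
  forall (rho xi : nat -> R) (xinf : nat -> nat -> R),
  (forall i, (i < nag P)%nat -> p3_lexopt P i (yinf i) (rho i) (xi i) (xinf i)) ->
  milp_feasible P xinf.
Proof.
  intros P _ Hok L xL lt sigma HL HxL [mx [Hsigma [[i1 [s1 [Hi1 [Hs1 Hmx]]]] Hmax]]]
    [zs [Hzs Huniq]].
  destruct (limit_allocation_optimal P (fun _ => sigma) zs Hok Hzs) as [M0 HM0].
  exists M0. intros M HM HMM0 adj Hconn alpha HB y z v mu Hinit Hpd Hupd yinf Hcv
    rho xi xinf Hlex.
  destruct (HM0 M HM HMM0 adj alpha Hconn HB y z v mu yinf Hinit Hpd Hupd Hcv)
    as [Hsum [zinf [Hopt Halloc]]].
  assert (Hmx0 : 0 <= mx).
  { rewrite Hmx. destruct (HxL i1 Hi1) as [HX _].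
    destruct (HL i1 s1 Hi1 Hs1) as [_ Hmin]. specialize (Hmin _ HX). lra. }
  set (B := fun i => if excluded_middle_informative (inX P i (zinf i))
                     then false else true).
  assert (Hfew : rsum (nag P) (fun i => if B i then 1 else 0) <= INR (ncon P)).
  { apply (few_nonintegral P (fun _ => sigma) zinf); auto.
    - intros z' Hz' i k Hi. rewrite (Huniq z'), (Huniq zinf); auto.
    - intros i Hi. unfold B.
      destruct (excluded_middle_informative (inX P i (zinf i))); [discriminate|auto]. }
  assert (Hrho : forall i, (i < nag P)%nat -> rho i <= mx * (if B i then 1 else 0)).
  { intros i Hi. destruct (Hlex i Hi) as [_ Hmin].
    assert (Hle : forall rho' xi' x', p3_feasible P i (yinf i) rho' xi' x' ->
                    rho i <= rho').
    { intros rho' xi' x' H. destruct (Hmin _ _ _ H) as [|[]]; lra. }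
    unfold B. destruct (excluded_middle_informative (inX P i (zinf i))) as [HX|_].
    (* The block [zinf i] itself competes in (P3) with zero violation. *)
    - rewrite Rmult_0_r. apply (Hle 0 (cx P i (zinf i)) (zinf i)).
      repeat split; try apply HX; try lra.
      intros s Hs. rewrite Rplus_0_r. auto.
    (* The competitor is [xL i]: A_i x_i^L <= L_i + mx <= A_i z_i + mx <= y_i + mx, the middle step
       because linear lower bounds on X_i extend to its hull. *)
    - rewrite Rmult_1_r. destruct (HxL i Hi) as [HX _].
      apply (Hle mx (cx P i (xL i)) (xL i)).
      repeat split; try apply HX; try lra.
      intros s Hs. specialize (Hmax i s Hi Hs). specialize (Halloc i s Hi Hs).
      assert (L i s <= Ax P i s (zinf i)).
      { apply inconv_Ax_lower; [apply HL; auto|].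
        destruct Hopt as [[Hc _] _]. auto. }
      lra. }
  split.
  - intros i Hi. apply (Hlex i Hi).
  - intros s Hs.
    apply Rle_trans with (rsum (nag P) (fun i => yinf i s + rho i)).
    + apply rsum_le. intros i Hi. destruct (Hlex i Hi) as [[_ [_ [_ H]]] _]. auto.
    + rewrite rsum_plus, Hsum by auto.
      (* With S the number of constraints, the left side is at most b - (S + 1) * mx + S * mx, and
         [mx] is nonnegative. *)
      assert (rsum (nag P) rho <= mx * INR (ncon P)).
      { eapply Rle_trans; [apply (rsum_le _ _ _ Hrho)|]. rewrite rsum_scal.
        apply Rmult_le_compat_l; auto. }
      rewrite plus_INR in Hsigma. simpl in Hsigma. nra.
Qed.
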